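(* Let $(Q,I)$ be a complete gentle quiver, $k$ a field, $\Lambda$ the arrow ideal completion of $kQ/I$, let $m$ be a map from the set of $\sigma$-orbits of $Q_1$ to the positive integers, and let $A=\Lambda/z\Lambda$ with $z=\sum_{a\in Q_1}c_a^{m(v_a)}$ be the associated twisted Brauer graph algebra. The following conditions are equivalent: (1) The order $\Lambda$ is symmetric, that is, $\nu_\Lambda\cong\mathrm{Id}$ or, equivalently, $\mathbb{S}_\Lambda\cong[1]$. (2) The algebra $A$ is symmetric, that is, $\nu_A\cong\mathrm{Id}$ or, equivalently, $\mathbb{S}_A\cong\mathrm{Id}$. (3) The graph of $\Lambda$ is bipartite or the base field $k$ has characteristic two.
   Context: $k$ is a field, $R=k[[t]]$. All modules are finitely generated left modules. Paths are composed from right to left; products of non-composable arrows are zero; $s(a)$ is the start vertex of an arrow $a$. A finite quiver with relations $(Q,I)$ is complete gentle if (1) there are exactly two arrows starting and exactly two arrows ending at each vertex; (2) for any arrow $b\in Q_1$ there are unique arrows $a,c\in Q_1$ such that $cb\notin I$ and $ba\notin I$; (3) the ideal $I$ is generated by paths of length two. For $a\in Q_1$ let $\sigma(a)$ be the unique arrow with $\sigma(a)a\notin I$; this defines a permutation $\sigma$ of $Q_1$. Let $v_a$ be the $\sigma$-orbit of $a$, $n(a)$ its length and $c_a=\sigma^{n(a)-1}(a)\cdots\sigma(a)a$ the repetition-free cyclic path starting with $a$. Graph: the graph $G$ of $(Q,I)$ (or of $\Lambda$) has as nodes the $\sigma$-orbits in $Q_1$ and, for each vertex $i\in Q_0$,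 one edge $e_i$ between $v_a$ and $v_b$, where $a,b$ are the two distinct arrows starting at $i$ (a loop if $v_a=v_b$). Multiple edges and loops are allowed. A graph is bipartite if its nodes can be coloured with two colours such that each edge is incident to nodes of different colours. $\Lambda$ is viewed as an $R$-order (an $R$-algebra free of finite rank over $R$) via $t\mapsto z$, so that $A\cong k\otimes_R\Lambda$. Let $\Lambda^\vee=\mathrm{Hom}_R(\Lambda,R)$ and $A^*=\mathrm{Hom}_k(A,k)$. $\Lambda$ is symmetric if $\Lambda\cong\Lambda^\vee$ as $\Lambda$-bimodules (this property does not depend on the choice of the $R$-algebra structure making $\Lambda$ an $R$-order); $A$ is symmetric if $A\cong A^*$ as $A$-bimodules. The derived Nakayama functors are $\nu_\Lambda=\Lambda^\vee\otimes^{\mathbb{L}}_\Lambda-$ on $D^-(\mathrm{mod}\,\Lambda)$ and $\nu_A=A^*\otimes^{\mathbb{L}}_A-$ on $D^-(\mathrm{mod}\,A)$; $\mathbb{S}_\Lambda=\nu_\Lambda\circ[1]$ and $\mathbb{S}_A=\nu_A$. *)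

(* Defs.v *)
From HB Require Import structures.
From mathcomp Require Import all_boot all_order all_fingroup all_algebra.
From mathcomp Require Import generic_quotient boolp.

Set Implicit Arguments.
Unset Strict Implicit.
Unset Printing Implicit Defensive.

Import Order.TTheory GRing.Theory Num.Theory.
Local Open Scope ring_scope.
Local Open Scope quotient_scope.

(* [zero_rel b a] says that the path ba is one of the generators of I.  As I is
   generated by paths of length two, it is spanned by the paths that contain a
   subpath ba with [zero_rel b a]; in particular ba \notin I is [nonzero b a]
   below (products of non-composable arrows vanish). *)
Record quiver := Quiver {
  vertex : finType;
  arrow : finType;
  src : arrow -> vertex;
  tgt : arrow -> vertex;
  zero_rel : rel arrow }.

Definition nonzero (Q : quiver) (b a : arrow Q) : bool :=
  (src b == tgt a) && ~~ zero_rel b a.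

Record complete_gentle (Q : quiver) : Prop := CompleteGentle {
  two_out : forall i : vertex Q, #|[set a : arrow Q | src a == i]| = 2%N;
  two_in : forall i : vertex Q, #|[set a : arrow Q | tgt a == i]| = 2%N;
  uniq_succ : forall b : arrow Q, exists! c : arrow Q, nonzero c b;
  uniq_pred : forall b : arrow Q, exists! a : arrow Q, nonzero b a }.

Record gentle_quiver := GentleQuiver {
  gquiver :> quiver;
  gentleP : complete_gentle gquiver }.

Section Sigma.
Variable Q : gentle_quiver.

Lemma ex_succ (a : arrow Q) : exists b, nonzero b a.
Proof. by have [b [Hb _]] := uniq_succ (gentleP Q) a; exists b. Qed.

Definition sigma_fun (a : arrow Q) : arrow Q := xchoose (ex_succ a).

Lemma sigma_funP a : nonzero (sigma_fun a) a.
Proof. exact: xchooseP (ex_succ a). Qed.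

Lemma sigma_inj : injective sigma_fun.
Proof.
move=> a b e; have [x [_ U]] := uniq_pred (gentleP Q) (sigma_fun a).
by rewrite -(U a (sigma_funP a)); apply: U; rewrite e sigma_funP.
Qed.

Definition sigma : {perm arrow Q} := perm sigma_inj.

Lemma sigmaP a b : nonzero b a = (b == sigma a).
Proof.
rewrite permE; apply/idP/eqP => [nz|->]; last exact: sigma_funP.
have [x [_ U]] := uniq_succ (gentleP Q) a.
by rewrite -(U _ nz) -(U _ (sigma_funP a)).
Qed.

Definition sorbit := {v : {set arrow Q} | v \in porbits sigma}.

Lemma porbit_in (a : arrow Q) : porbit sigma a \in porbits sigma.
Proof. exact: imset_f. Qed.

Definition orb (a : arrow Q) : sorbit := 
  exist (fun v : {set arrow Q} => v \in porbits sigma) _ (porbit_in a).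

Definition norb (a : arrow Q) : nat := #|porbit sigma a|.

End Sigma.

(* [joins e u v]: the (unoriented) edge e connects the nodes u and v. *)
Record multigraph := Multigraph {
  node : finType;
  edge : finType;
  joins : edge -> node -> node -> bool }.

Definition bipartite (G : multigraph) : Prop :=
  exists col : node G -> bool,
    forall (e : edge G) (u v : node G), joins e u v -> col u != col v.

Definition quiver_graph (Q : gentle_quiver) : multigraph :=
  {| node := sorbit Q;
     edge := vertex Q;
     joins := fun i u v => [exists a : arrow Q, exists b : arrow Q,
       [&& a != b, src a == i, src b == i, u == orb a & v == orb b]] |}.

(* A path al ... a2 a1 starting at i is the pair (i, [:: a1; a2; ...; al]), its
   arrows being listed in the order in which they are traversed; (i, [::]) is
   the trivial path at i.  [qpath Q] is the type of the paths not in I. *)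
Section Paths.
Variable Q : quiver.

Definition nz_path (p : vertex Q * seq (arrow Q)) : bool :=
  if p.2 is a :: s then (src a == p.1) && path (fun a b => nonzero b a) a s
  else true.

Definition qpath := {p : vertex Q * seq (arrow Q) | nz_path p}.

Definition plen (p : qpath) : nat := size (val p).2.

Lemma take_nz (p : qpath) n : nz_path ((val p).1, take n (val p).2).
Proof.
case: p => -[i [|a s]] //= /andP[/= si pa]; case: n => [|n] //=.
by rewrite /nz_path /= si /= take_path.
Qed.

Lemma drop_nz (p : qpath) n :
  nz_path (last (val p).1 (map (@tgt Q) (take n (val p).2)), drop n (val p).2).
Proof.
case: p => -[i s] /=; elim: n i s => [|n IH] i [|a s] //=.
move=> /andP[_ pa]; apply: IH; case: s pa => [|b s] //=.
by rewrite /nz_path /= => /andP[/andP[sb _] ps]; apply/andP.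
Qed.

(* p = (pdrop p n) (ptake p n): ptake consists of the first n arrows
   traversed, pdrop of the remaining ones. *)
Definition ptake (p : qpath) n : qpath := exist (fun q => nz_path q) _ (take_nz p n).
Definition pdrop (p : qpath) n : qpath := exist (fun q => nz_path q) _ (drop_nz p n).

End Paths.

(* The ideal I being monomial, the paths not in I form a k-basis of kQ/I, and
   those of length at least n a basis of the n-th power of the arrow ideal.
   Hence the inverse limit over n consists of the formal, possibly infinite,
   k-linear combinations of paths not in I, multiplied by concatenation. *)
Definition completion (k : fieldType) (Q : quiver) := qpath Q -> k.

Section Completion.
Variables (k : fieldType) (Q : quiver).
Local Notation L := (completion k Q).
Implicit Types (f g h : L) (p : qpath Q).

HB.instance Definition _ := gen_eqMixin L.
HB.instance Definition _ := gen_choiceMixin L.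

Definition cadd f g : L := fun p => f p + g p.
Definition copp f : L := fun p => - f p.
Definition czero : L := fun _ => 0.

Fact caddA : associative cadd.
Proof. by move=> f g h; apply: funext => p; rewrite /cadd addrA. Qed.
Fact caddC : commutative cadd.
Proof. by move=> f g; apply: funext => p; rewrite /cadd addrC. Qed.
Fact cadd0 : left_id czero cadd.
Proof. by move=> f; apply: funext => p; rewrite /cadd add0r. Qed.
Fact caddN : left_inverse czero copp cadd.
Proof. by move=> f; apply: funext => p; rewrite /cadd addNr. Qed.

HB.instance Definition _ := GRing.isZmodule.Build L caddA caddC cadd0 caddN.

(* The coefficient of p in f g is the sum over all factorisations p = q r of
   the coefficient of q in f times the coefficient of r in g. *)
Definition cmul f g : L :=
  fun p => \sum_(0 <= j < (plen p).+1) f (pdrop p j) * g (ptake p j).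
Definition cone : L := fun p => (plen p == 0)%:R.

Lemma plen_take p n : plen (ptake p n) = minn n (plen p).
Proof. by rewrite /plen /= size_take_min. Qed.
Lemma plen_drop p n : plen (pdrop p n) = (plen p - n)%N.
Proof. by rewrite /plen /= size_drop. Qed.
Lemma ptake_size p : ptake p (plen p) = p.
Proof. by apply: val_inj; case: p => -[i s] ?; rewrite /= /plen /= take_size. Qed.
Lemma pdrop0 p : pdrop p 0 = p.
Proof. by apply: val_inj; case: p => -[i s] ?; rewrite /= take0 drop0. Qed.
Lemma pdrop_drop p i j : pdrop (pdrop p j) i = pdrop p (j + i).
Proof.
apply: val_inj; rewrite /= drop_drop addnC; congr (_, _).
by rewrite -last_cat -map_cat -takeD addnC.
Qed.
Lemma ptake_take p i j : (i <= j)%N -> ptake (ptake p j) i = ptake p i.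
Proof. by move=> ij; apply: val_inj; rewrite /= take_takel. Qed.
Lemma ptake_drop p i j : ptake (pdrop p j) i = pdrop (ptake p (j + i)) j.
Proof.
by apply: val_inj; rewrite /= take_takel ?leq_addr // take_drop addnC.
Qed.

Lemma sum_triangle (V : nmodType) n (F : nat -> nat -> V) :
  \sum_(0 <= l < n.+1) \sum_(0 <= j < l.+1) F l j =
  \sum_(0 <= j < n.+1) \sum_(0 <= i < (n - j).+1) F (j + i)%N j.
Proof.
elim: n => [|n IH]; first by rewrite !big_nat1.
rewrite big_nat_recr //= IH [in RHS]big_nat_recr //= subnn big_nat1 addn0.
rewrite [X in _ + X = _]big_nat_recr //= addrA; congr (_ + _).
rewrite -big_split; apply: eq_big_nat => j /andP[_ jn] /=.
by rewrite subSn // [RHS]big_nat_recr //= addnS subnKC.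
Qed.

Fact cmulA : associative cmul.
Proof.
move=> f g h; apply: funext => p; rewrite /cmul.
under eq_big_nat => l /andP[_ ll] do
  rewrite plen_take (minn_idPl (ll : (l <= plen p)%N)) mulr_sumr.
rewrite sum_triangle; apply: eq_big_nat => j /andP[_ jl].
rewrite plen_drop mulr_suml; apply: eq_big_nat => i /andP[_ il].
by rewrite pdrop_drop ptake_drop ptake_take ?leq_addr // mulrA.
Qed.

Fact cmul1 : left_id cone cmul.
Proof.
move=> f; apply: funext => p; rewrite /cmul /cone big_nat_recr //= plen_drop.
rewrite subnn eqxx mul1r ptake_size big_nat big1 ?add0r // => j /andP[_ jl].
by rewrite plen_drop subn_eq0 leqNgt jl mul0r.
Qed.

Fact cmulr1 : right_id cone cmul.
Proof.
move=> f; apply: funext => p; rewrite /cmul /cone big_nat_recl //= plen_take.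
rewrite min0n eqxx mulr1 pdrop0 big_nat big1 ?addr0 // => j /andP[_ jl].
by rewrite plen_take (minn_idPl (jl : (j.+1 <= plen p)%N)) mulr0.
Qed.

Fact cmulDl : left_distributive cmul cadd.
Proof.
move=> f g h; apply: funext => p; rewrite /cadd /cmul -big_split.
by apply: eq_bigr => j _; rewrite mulrDl.
Qed.

Fact cmulDr : right_distributive cmul cadd.
Proof.
move=> f g h; apply: funext => p; rewrite /cadd /cmul -big_split.
by apply: eq_bigr => j _; rewrite mulrDr.
Qed.

HB.instance Definition _ :=
  GRing.Zmodule_isPzRing.Build L cmulA cmul1 cmulr1 cmulDl cmulDr.

(* The class in kQ/I of the path (i, s); it vanishes if (i, s) is not a path or
   lies in I. *)
Definition mono (i : vertex Q) (s : seq (arrow Q)) : L :=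
  fun p => (val p == (i, s))%:R.

Definition cscal (c : k) : L := fun p => c * (plen p == 0)%:R.

Lemma caddE f g p : (f + g) p = f p + g p. Proof. by []. Qed.
Lemma coppE f p : (- f) p = - f p. Proof. by []. Qed.
Lemma czeroE p : (0 : L) p = 0. Proof. by []. Qed.
Lemma coneE p : (1 : L) p = (plen p == 0)%:R. Proof. by []. Qed.
Lemma cmulE f g p : (f * g) p =
  \sum_(0 <= j < (plen p).+1) f (pdrop p j) * g (ptake p j).
Proof. by []. Qed.
Lemma csumE I r (P : pred I) (F : I -> L) p :
  (\sum_(i <- r | P i) F i) p = \sum_(i <- r | P i) F i p.
Proof. by elim/big_rec2: _ => // i x y _ <-. Qed.

Lemma mono_cat i s j t : last i (map (@tgt Q) s) = j ->
  mono j t * mono i s = mono i (s ++ t).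
Proof.
move=> ej; apply: funext => p; rewrite cmulE /mono.
have [ep|np] := eqVneq (val p) (i, s ++ t).
  have ss : (size s < (plen p).+1)%N.
    by rewrite /plen ep size_cat ltnS leq_addr.
  rewrite big_mkord (bigD1 (Ordinal ss)) //= [X in _ + X]big1 ?addr0.
    by rewrite ep /= take_size_cat // drop_size_cat // ej !eqxx mulr1.
  move=> [l /= ll] /eqP nl; case: eqVneq => [_|]; last by rewrite mul0r.
  case: eqVneq => [[_ es]|]; last by rewrite mulr0.
  case: nl; apply: val_inj => /=.
  by rewrite -es size_take_min (minn_idPl _) // -ltnS.
rewrite big1 // => l _.
case: eqVneq => [[e1 e2]|]; last by rewrite mul0r.
case: eqVneq => [[e3 e4]|]; last by rewrite mulr0.
by case/eqP: np; rewrite -e2 -e4 cat_take_drop -e3 -surjective_pairing.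
Qed.

Lemma cscalM c f p : (cscal c * f) p = c * f p.
Proof.
rewrite cmulE /cscal big_nat_recr //= plen_drop subnn eqxx mulr1 ptake_size.
rewrite big_nat big1 ?add0r // => j /andP[_ jl].
by rewrite plen_drop subn_eq0 leqNgt jl mulr0 mul0r.
Qed.

Lemma cMscal c f p : (f * cscal c) p = c * f p.
Proof.
rewrite cmulE /cscal big_nat_recl //= plen_take min0n eqxx mulr1 pdrop0 mulrC.
rewrite big_nat big1 ?addr0 // => j /andP[_ jl].
by rewrite plen_take (minn_idPl (jl : (j.+1 <= plen p)%N)) !mulr0.
Qed.

End Completion.

(* [completion k Q] is indeed the arrow ideal completion of kQ/I.  The path
   algebra kQ consists of the finitely supported elements for the quiver
   without zero relations, [IJ n] is the ideal I + J^n of kQ, and [proj] induces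
   an isomorphism from lim_n kQ/(I + J^n) to [completion k Q], by
   [completion_ker], [completion_lim] and [completion_dense]. *)
Section CompletionSpec.
Variables (k : fieldType) (Q : quiver).

Definition free_quiver := Quiver (@src Q) (@tgt Q) (fun _ _ => false).
Local Notation L := (completion k Q).
Local Notation KQ := (completion k free_quiver).

Definition finsupp (f : KQ) : Prop :=
  exists s : seq (qpath free_quiver), forall p, f p != 0 -> p \in s.

Inductive IJ (n : nat) : KQ -> Prop :=
| IJ_rel i (a b : arrow Q) : zero_rel b a ->
    IJ n (mono k (i : vertex free_quiver) [:: (a : arrow free_quiver); b])
| IJ_pow i (s : seq (arrow free_quiver)) : size s = n -> IJ n (mono k i s)
| IJ_0 : IJ n 0
| IJ_D f g : IJ n f -> IJ n g -> IJ n (f + g)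
| IJ_Z c f : IJ n f -> IJ n (cscal c * f)
| IJ_M f g h : finsupp f -> finsupp h -> IJ n g -> IJ n (f * g * h).

Lemma forget_nz (p : qpath Q) : @nz_path free_quiver (val p).
Proof.
case: p => -[i [|a s]] //=; rewrite /nz_path /= => /andP[-> ps] /=.
by apply: sub_path ps => b c /andP[+ _]; rewrite /nonzero andbT.
Qed.

Definition forget (p : qpath Q) : qpath free_quiver :=
  exist (fun q => @nz_path free_quiver q) _ (forget_nz p).

Definition proj (f : KQ) : L := fun p => f (forget p).

Lemma mono_finsupp i s : finsupp (mono k i s).
Proof.
have [nz|nnz] := boolP (@nz_path free_quiver (i, s)).
  exists [:: exist (fun q => @nz_path free_quiver q) _ nz] => p.
  rewrite /mono; case: (eqVneq (val p) (i, s)) => [e _|_]; last by rewrite eqxx.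
  by rewrite inE; apply/eqP/val_inj.
exists [::] => p; rewrite /mono; case: (eqVneq (val p) (i, s)) => [e|_]; last by rewrite eqxx.
by rewrite -e (valP p) in nnz.
Qed.

Lemma zero_factor (c : arrow Q) s :
    path (fun a b => @nonzero free_quiver b a) c s ->
    ~~ path (fun a b => nonzero b a) c s ->
  exists s1 b d s2, c :: s = s1 ++ [:: b, d & s2] /\ zero_rel d b.
Proof.
elim: s c => //= e s IH c /andP[ec es]; rewrite negb_and => /orP[nz|nz].
  exists [::], c, e, s; split=> //.
  have ec' : src e == tgt c by case/andP: ec.
  by move: nz; rewrite /nonzero ec' /= negbK.
by have [s1 [b [d [s2 [-> bd]]]]] := IH e es nz; exists (c :: s1), b, d, s2.
Qed.

Lemma IJ_mono n (p : qpath free_quiver) :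
  ~~ nz_path (val p : vertex Q * seq (arrow Q)) || (n <= plen p)%N ->
  IJ n (mono k (val p).1 (val p).2).
Proof.
case/orP => [|np]; last first.
  have -> : mono k (val p).1 (val p).2 =
      mono k (val (pdrop p n)).1 (val (pdrop p n)).2
      * mono k (val p).1 (take n (val p).2) * mono k (val p).1 [::].
    by rewrite !mono_cat //= cat_take_drop.
  apply: IJ_M; try exact: mono_finsupp.
  by apply: IJ_pow; rewrite size_take_min (minn_idPl np).
case: p => -[i [|a s]] //= np; rewrite /nz_path /=.
case/andP: np => /= /eqP <- ps; rewrite eqxx /= => nps.
have [s1 [b [d [s2 [-> bd]]]]] := zero_factor ps nps.
pose j := last (src a) (map (@tgt free_quiver) s1).
have -> : mono k (src a : vertex free_quiver) (s1 ++ [:: b, d & s2]) =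
    mono k (tgt d : vertex free_quiver) s2
    * mono k j [:: (b : arrow free_quiver); d] * mono k (src a) s1.
  by rewrite !mono_cat.
by apply: IJ_M; try exact: mono_finsupp; apply: IJ_rel.
Qed.

Lemma completion_ker n (f : KQ) : finsupp f ->
  IJ n f <-> forall p, (plen p < n)%N -> proj f p = 0.
Proof.
move=> [s fs]; split=> [|f0].
  elim=> {f s fs} [i a b ab|i s sn||f g _ IHf _ IHg|c f _ IHf|f g h _ _ _ IHg] p pn.
  - rewrite /proj /mono; case: eqP => //= e.
    have : @nz_path Q (i, [:: a; b]) by rewrite -e; apply: (valP p).
    by rewrite /nz_path /= /nonzero ab !andbF.
  - rewrite /proj /mono; case: eqP => //= e.
    have sp : size (val p).2 = n by rewrite -sn; apply: (congr1 (fun q => size q.2) e).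
    by move: pn; rewrite /plen sp ltnn.
  - by [].
  - by rewrite /proj caddE [f _]IHf // [g _]IHg // addr0.
  - by rewrite /proj cscalM [f _]IHf // mulr0.
  - rewrite /proj cmulE big_nat big1 // => j _; rewrite cmulE big_nat.
    rewrite big1 ?mul0r // => l _; rewrite [X in _ * X](_ : _ = 0) ?mulr0 //.
    have -> : ptake (pdrop (forget p) j) l = forget (ptake (pdrop p j) l).
      exact: val_inj.
    apply: IHg; rewrite plen_take plen_drop.
    by rewrite (leq_ltn_trans (geq_minr _ _)) // (leq_ltn_trans (leq_subr _ _)).
have -> : f = \sum_(p <- undup s) cscal (f p) * mono k (val p).1 (val p).2.
  apply: funext => q; rewrite csumE.
  under eq_bigr => p _ do rewrite cscalM /mono -surjective_pairing val_eqE.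
  have [qs|qs] := boolP (q \in undup s).
    rewrite (bigD1_seq q) ?undup_uniq //= eqxx mulr1 big1 ?addr0 // => p pq.
    by rewrite eq_sym (negPf pq) mulr0.
  rewrite big_seq big1; last first.
    by move=> p ps; case: eqP => [e|]; rewrite ?mulr0 // e ps in qs *.
  by apply/eqP; apply: contraNT qs => /fs; rewrite mem_undup.
elim/big_ind: _ => [|g h|p _]; [exact: IJ_0|exact: IJ_D|].
have [np|] := boolP (~~ nz_path (val p : vertex Q * seq (arrow Q)) || (n <= plen p)%N).
  by apply/IJ_Z/IJ_mono.
rewrite negb_or negbK -ltnNge => /andP[nz pn].
pose p' : qpath Q := exist (fun q => nz_path q) _ nz.
have -> : f p = 0 by rewrite -(f0 p') //; congr f; apply: val_inj.
have -> : cscal 0 * mono k (val p).1 (val p).2 = 0 :> KQ; last exact: IJ_0.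
by apply: funext => q; rewrite cscalM mul0r.
Qed.

Lemma completion_dense n (f : L) :
  exists2 g, finsupp g & forall p, (plen p < n)%N -> proj g p = f p.
Proof.
pose g : KQ := fun q =>
  if insub (val q : vertex Q * seq (arrow Q)) is Some p
  then if (plen p < n)%N then f p else 0 else 0.
exists g => [|p pn]; last first.
  rewrite /proj /g; case: insubP => [u _ eu|]; last by rewrite (valP p).
  by rewrite (val_inj eu) pn.
pose paths l := [seq (i, tval t) | i <- enum (vertex Q), t <- enum {: l.-tuple (arrow Q)}].
exists (pmap insub (flatten [seq paths l | l <- iota 0 n])) => q.
rewrite mem_pmap_sub /g; case: insubP => [u _ eu|]; last by rewrite eqxx.
case: ltnP => [un _|]; last by rewrite eqxx.
rewrite -eu; apply/flatten_mapP; exists (plen u); first by rewrite mem_iota.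
apply/allpairsP; exists ((val u).1, in_tuple (val u).2); split=> /=.
- by rewrite mem_enum.
- by rewrite mem_enum.
- exact: surjective_pairing.
Qed.

Lemma completion_lim (F : nat -> KQ) :
    (forall n, finsupp (F n)) -> (forall n, IJ n (F n.+1 - F n)) ->
  exists! f : L, forall n p, (plen p < n)%N -> proj (F n) p = f p.
Proof.
move=> Ffin Fc.
have FS n p : (plen p < n)%N -> proj (F n.+1) p = proj (F n) p.
  move=> pn; have fin : finsupp (F n.+1 - F n).
    have [[s sP] [t tP]] := (Ffin n.+1, Ffin n); exists (s ++ t) => q.
    apply: contraR; rewrite mem_cat negb_or => /andP[qs qt].
    have e1 : F n.+1 q = 0 by apply/eqP; apply: contraNT qs => /sP.
    have e2 : F n q = 0 by apply/eqP; apply: contraNT qt => /tP.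
    by apply/eqP; rewrite -(subr0 0) -{1}e1 -e2.
  have [ker _] := completion_ker n fin.
  have e : proj (F n.+1) p - proj (F n) p = 0 := ker (Fc n) p pn.
  by apply/eqP; rewrite -subr_eq0 e.
exists (fun p => proj (F (plen p).+1) p); split=> [n p|f fP].
  elim: n => // n IH; rewrite ltnS leq_eqVlt => /orP[/eqP <-//|pn].
  by rewrite FS // IH.
by apply: funext => p; rewrite fP.
Qed.

End CompletionSpec.

Definition pseries (k : fieldType) := nat -> k.

Section PowerSeries.
Variable k : fieldType.
Local Notation R := (pseries k).
Implicit Types f g h : R.

HB.instance Definition _ := gen_eqMixin R.
HB.instance Definition _ := gen_choiceMixin R.

Definition psadd f g : R := fun n => f n + g n.
Definition psopp f : R := fun n => - f n.
Definition pszero : R := fun _ => 0.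

Fact psaddA : associative psadd.
Proof. by move=> f g h; apply: funext => n; rewrite /psadd addrA. Qed.
Fact psaddC : commutative psadd.
Proof. by move=> f g; apply: funext => n; rewrite /psadd addrC. Qed.
Fact psadd0 : left_id pszero psadd.
Proof. by move=> f; apply: funext => n; rewrite /psadd add0r. Qed.
Fact psaddN : left_inverse pszero psopp psadd.
Proof. by move=> f; apply: funext => n; rewrite /psadd addNr. Qed.

HB.instance Definition _ := GRing.isZmodule.Build R psaddA psaddC psadd0 psaddN.

Definition psmul f g : R :=
  fun n => \sum_(0 <= i < n.+1) f i * g (n - i)%N.
Definition psone : R := fun n => (n == 0)%:R.

Fact psmulC : commutative psmul.
Proof.
move=> f g; apply: funext => n; rewrite /psmul big_nat_rev /=.
apply: eq_big_nat => i /andP[_ il].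
by rewrite add0n subSS subKn // mulrC.
Qed.

Fact psmulA : associative psmul.
Proof.
move=> f g h; apply: funext => n; rewrite /psmul.
under [RHS]eq_bigr => l _ do rewrite mulr_suml.
rewrite sum_triangle; apply: eq_big_nat => j /andP[_ jl].
rewrite mulr_sumr; apply: eq_big_nat => i /andP[_ il].
by rewrite mulrA addKn subnDA.
Qed.

Fact psmul1 : left_id psone psmul.
Proof.
move=> f; apply: funext => n; rewrite /psmul /psone big_nat_recl //= mul1r subn0.
by rewrite big1 ?addr0 // => i _; rewrite mul0r.
Qed.

Fact psmulDl : left_distributive psmul psadd.
Proof.
move=> f g h; apply: funext => n; rewrite /psadd /psmul -big_split.
by apply: eq_bigr => i _; rewrite mulrDl.
Qed.

HB.instance Definition _ :=
  GRing.Zmodule_isComPzRing.Build R psmulA psmulC psmul1 psmulDl.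

End PowerSeries.

(* A K-algebra structure on a ring S is a morphism from K to the centre of S. *)
Record algebra (K : comPzRingType) (S : pzRingType) := Algebra {
  alg_str :> {rmorphism K -> S};
  alg_central : forall c x, alg_str c * x = x * alg_str c }.

Record bimod (S : pzRingType) := Bimod {
  bcar :> zmodType;
  lact : S -> bcar -> bcar;
  ract : bcar -> S -> bcar;
  lact1 : forall x, lact 1 x = x;
  lactM : forall a b x, lact (a * b) x = lact a (lact b x);
  lactDl : forall a b x, lact (a + b) x = lact a x + lact b x;
  lactDr : forall a x y, lact a (x + y) = lact a x + lact a y;
  ract1 : forall x, ract x 1 = x;
  ractM : forall x a b, ract x (a * b) = ract (ract x a) b;
  ractDl : forall x y a, ract (x + y) a = ract x a + ract y a;
  ractDr : forall x a b, ract x (a + b) = ract x a + ract x b;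
  lractA : forall a x b, ract (lact a x) b = lact a (ract x b) }.
Arguments lact {S _}.
Arguments ract {S _}.

Definition bimod_iso (S : pzRingType) (M N : bimod S) : Prop :=
  exists f : M -> N,
    [/\ bijective f,
        forall x y, f (x + y) = f x + f y,
        forall a x, f (lact a x) = lact a (f x)
      & forall x a, f (ract x a) = ract (f x) a].

Definition regular_bimod (S : pzRingType) : bimod S :=
  @Bimod S S (fun a x => a * x) (fun x a => x * a)
    (@mul1r S) (fun a b x => esym (mulrA a b x)) (fun a b x => mulrDl a b x)
    (fun a x y => mulrDr a x y) (@mulr1 S) (fun x a b => mulrA x a b)
    (fun x y a => mulrDl x y a) (fun x a b => mulrDr x a b)
    (fun a x b => esym (mulrA a x b)).

(* Hom_K(S, K) with (a phi b)(x) = phi (b x a). *)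
Section Dual.
Variables (K : comPzRingType) (S : pzRingType) (al : algebra K S).

Record dual := Dual {
  dfun :> S -> K;
  dualD : forall x y, dfun (x + y) = dfun x + dfun y;
  dualZ : forall c x, dfun (al c * x) = c * dfun x }.

Lemma dual_eq (f g : dual) : f =1 g -> f = g.
Proof.
case: f g => [f fD fZ] [g gD gZ] /= /funext e.
by rewrite -{}e in gD gZ *; congr Dual; exact: Prop_irrelevance.
Qed.

HB.instance Definition _ := gen_eqMixin dual.
HB.instance Definition _ := gen_choiceMixin dual.

Definition dadd (f g : dual) : dual.
Proof.
exists (fun x => f x + g x) => [x y|c x]; first by rewrite !dualD addrACA.
by rewrite !dualZ mulrDr.
Defined.

Definition dopp (f : dual) : dual.
Proof.
exists (fun x => - f x) => [x y|c x]; first by rewrite dualD opprD.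
by rewrite dualZ mulrN.
Defined.

Definition dzero : dual.
Proof. by exists (fun _ => 0) => *; rewrite ?addr0 ?mulr0. Defined.

Fact daddA : associative dadd.
Proof. by move=> f g h; apply: dual_eq => x /=; rewrite addrA. Qed.
Fact daddC : commutative dadd.
Proof. by move=> f g; apply: dual_eq => x /=; rewrite addrC. Qed.
Fact dadd0 : left_id dzero dadd.
Proof. by move=> f; apply: dual_eq => x /=; rewrite add0r. Qed.
Fact daddN : left_inverse dzero dopp dadd.
Proof. by move=> f; apply: dual_eq => x /=; rewrite addNr. Qed.

HB.instance Definition _ := GRing.isZmodule.Build dual daddA daddC dadd0 daddN.

Definition dlact (a : S) (f : dual) : dual.
Proof.
exists (fun x => f (x * a)) => [x y|c x]; first by rewrite mulrDl dualD.
by rewrite -mulrA dualZ.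
Defined.

Definition dract (f : dual) (a : S) : dual.
Proof.
exists (fun x => f (a * x)) => [x y|c x]; first by rewrite mulrDr dualD.
by rewrite mulrA -alg_central -mulrA dualZ.
Defined.

Definition dual_bimod : bimod S.
Proof.
exists dual dlact dract.
- by move=> f; apply: dual_eq => x /=; rewrite mulr1.
- by move=> a b f; apply: dual_eq => x /=; rewrite mulrA.
- by move=> a b f; apply: dual_eq => x /=; rewrite mulrDr dualD.
- by move=> a f g; apply: dual_eq => x.
- by move=> f; apply: dual_eq => x /=; rewrite mul1r.
- by move=> f a b; apply: dual_eq => x /=; rewrite mulrA.
- by move=> f g a; apply: dual_eq => x.
- by move=> f a b; apply: dual_eq => x /=; rewrite mulrDl dualD.
- by move=> a f b; apply: dual_eq => x /=; rewrite mulrA.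
Defined.

End Dual.

Definition symmetric_alg (K : comPzRingType) (S : pzRingType) (al : algebra K S) :=
  bimod_iso (regular_bimod S) (dual_bimod al).

Section CentralQuotient.
Variables (S : pzRingType) (z : S) (zC : forall x, z * x = x * z).

Definition mult_of : {pred S} := fun x => `[< exists w, x = z * w >].

Fact mult_of_zmod_closed : zmod_closed mult_of.
Proof.
split=> [|x y /asboolP[u ->] /asboolP[v ->]]; apply/asboolP.
  by exists 0; rewrite mulr0.
by exists (u - v); rewrite mulrBr.
Qed.

HB.instance Definition _ :=
  GRing.isZmodClosed.Build S mult_of mult_of_zmod_closed.

Definition cquot of (forall x, z * x = x * z) := Quotient.quot mult_of.
Local Notation A := (cquot zC).

HB.instance Definition _ := GRing.Zmodule.on A.
HB.instance Definition _ := EqQuotient.on A.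

Definition cquot_pi (x : S) : A := \pi_A x.

Lemma cquot_piP x y : (cquot_pi x = cquot_pi y) <-> exists w, x - y = z * w.
Proof.
split=> [/eqP|e]; first by rewrite /cquot_pi eqmodE => /asboolP.
by apply/eqP; rewrite /cquot_pi eqmodE; apply/asboolP.
Qed.

Lemma cquot_piK (x : A) : cquot_pi (repr x) = x. Proof. exact: reprK. Qed.

Lemma cquot_piD x y : cquot_pi (x + y) = cquot_pi x + cquot_pi y.
Proof. by rewrite /cquot_pi (Quotient.pi_add mult_of). Qed.

Definition cquot_mul (x y : A) : A := cquot_pi (repr x * repr y).
Definition cquot_one : A := cquot_pi 1.

Lemma cquot_piM x y : cquot_pi (x * y) = cquot_mul (cquot_pi x) (cquot_pi y).
Proof.
apply/cquot_piP.
have /cquot_piP[u eu] := esym (cquot_piK (cquot_pi x)).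
have /cquot_piP[v ev] := esym (cquot_piK (cquot_pi y)).
set x' := repr _ in eu *; set y' := repr _ in ev *.
exists (u * y + x' * v).
rewrite mulrDr !mulrA -eu zC -mulrA -ev mulrBl mulrBr addrA.
by rewrite subrK.
Qed.

Fact cquot_mulA : associative cquot_mul.
Proof.
move=> x y w; rewrite -[x]cquot_piK -[y]cquot_piK -[w]cquot_piK.
by rewrite -!cquot_piM mulrA.
Qed.
Fact cquot_mul1 : left_id cquot_one cquot_mul.
Proof. by move=> x; rewrite -[x]cquot_piK -cquot_piM mul1r. Qed.
Fact cquot_mulr1 : right_id cquot_one cquot_mul.
Proof. by move=> x; rewrite -[x]cquot_piK -cquot_piM mulr1. Qed.
Fact cquot_mulDl : left_distributive cquot_mul +%R.
Proof.
move=> x y w; rewrite -[x]cquot_piK -[y]cquot_piK -[w]cquot_piK.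
by rewrite -cquot_piD -!cquot_piM -cquot_piD mulrDl.
Qed.
Fact cquot_mulDr : right_distributive cquot_mul +%R.
Proof.
move=> x y w; rewrite -[x]cquot_piK -[y]cquot_piK -[w]cquot_piK.
by rewrite -cquot_piD -!cquot_piM -cquot_piD mulrDr.
Qed.

HB.instance Definition _ := GRing.Zmodule_isPzRing.Build A
  cquot_mulA cquot_mul1 cquot_mulr1 cquot_mulDl cquot_mulDr.

Fact cquot_pi_zmod : zmod_morphism cquot_pi.
Proof.
by move=> x y; apply/eqP; rewrite eq_sym subr_eq -cquot_piD subrK.
Qed.
Fact cquot_pi_monoid : monoid_morphism cquot_pi.
Proof. by split=> // x y; rewrite cquot_piM. Qed.

HB.instance Definition _ := GRing.isZmodMorphism.Build S A cquot_pi cquot_pi_zmod.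
HB.instance Definition _ :=
  GRing.isMonoidMorphism.Build S A cquot_pi cquot_pi_monoid.

End CentralQuotient.

Definition multiplicity (Q : gentle_quiver) := sorbit Q -> {n : nat | 0 < n}%N.

Section Brauer.
Variables (k : fieldType) (Q : gentle_quiver) (m : multiplicity Q).
Local Notation L := (completion k Q).

(* c_a = sigma^(n(a)-1)(a) ... sigma(a) a *)
Definition cyc (a : arrow Q) : L := mono k (src a) (traject (sigma Q) a (norb a)).

Definition zelt : L := \sum_(a : arrow Q) cyc a ^+ val (m (orb a)).

(* The length of the path c_a^m(v_a) *)
Definition zlen (a : arrow Q) : nat := (norb a * val (m (orb a)))%N.

Lemma zlen_gt0 a : (0 < zlen a)%N.
Proof.
rewrite muln_gt0 (valP (m (orb a))) andbT.
by apply/card_gt0P; exists a; rewrite porbit_id.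
Qed.

Lemma src_sigma a : src (sigma Q a) = tgt a.
Proof.
have : nonzero (sigma Q a) a by rewrite sigmaP.
by case/andP => /eqP.
Qed.

Lemma last_traject a n :
  last (src a) (map (@tgt Q) (traject (sigma Q) a n)) = src (iter n (sigma Q) a).
Proof.
elim: n a => //= n IH a; rewrite -src_sigma IH.
by rewrite -iterSr.
Qed.

Lemma iter_norb a n : iter (norb a * n) (sigma Q) a = a.
Proof. by elim: n => [|n IH]; rewrite ?muln0 // mulnS iterD IH iter_porbit. Qed.

Lemma cycX a n :
  cyc a ^+ n.+1 = mono k (src a) (traject (sigma Q) a (norb a * n.+1)).
Proof.
elim: n => [|n IH]; first by rewrite muln1.
rewrite exprSr IH /cyc mono_cat; last by rewrite last_traject iter_porbit.
by rewrite [in RHS]mulnS trajectD iter_porbit.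
Qed.

Lemma qpath_traject (p : qpath Q) a s : (val p).2 = a :: s ->
  val p = (src a, traject (sigma Q) a (plen p)).
Proof.
case: p => -[i t] /= np et; rewrite /plen /=; subst t.
case/andP: np => /= /eqP <- pa; congr (_, _ :: _).
elim: s a pa => //= b s IH a /andP[]; rewrite sigmaP => /eqP -> ps.
by congr (_ :: _); apply: IH.
Qed.

Lemma zeltE (p : qpath Q) :
  zelt p = (if (val p).2 is a :: _ then plen p == zlen a else false)%:R.
Proof.
rewrite /zelt csumE.
have cE a : (cyc a ^+ val (m (orb a))) p =
    (val p == (src a, traject (sigma Q) a (zlen a)))%:R.
  rewrite /zlen; case: (m (orb a)) => -[|n] //= _.
  by rewrite cycX.
under eq_bigr => a _ do rewrite cE.
case ep: (val p).2 => [|b s].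
  rewrite big1 // => a _; case: eqP => // e.
  have := congr1 (fun q => size q.2) e; rewrite ep /= size_traject => e0.
  by have := zlen_gt0 a; rewrite -e0.
have epp := qpath_traject ep.
rewrite (bigD1 b) //= big1 ?addr0 => [|a ab]; rewrite epp.
  rewrite xpair_eqE eqxx /=; congr (nat_of_bool _)%:R.
  apply/eqP/eqP => [/(congr1 size)|->//]; by rewrite !size_traject.
case: eqP => // -[_ e]; case/eqP: ab.
have: (0 < zlen a)%N := zlen_gt0 a.
move: e; rewrite /plen ep /=; by case: (zlen a) => //= n [].
Qed.

Lemma zlen_iter a n : zlen (iter n (sigma Q) a) = zlen a.
Proof.
have e : orb (iter n (sigma Q) a) = orb a.
  apply: val_inj; rewrite /=; apply/eqP; rewrite eq_porbit_mem.
  by rewrite -permX; apply: mem_porbit.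
by rewrite /zlen e; congr (_ * _)%N; rewrite /norb -![porbit _ _]/(val (orb _)) e.
Qed.

Lemma zelt_central (x : L) : zelt * x = x * zelt.
Proof.
apply: funext => p; rewrite !cmulE.
case ep: (val p).2 => [|a s].
  have l0: plen p = 0%N by rewrite /plen ep.
  by rewrite l0 !big_nat1 !zeltE /= ep mul0r mulr0.
have epp := qpath_traject ep.
rewrite [RHS]big_nat_rev /=; apply: eq_big_nat => j /andP[_ jl].
rewrite add0n subSS mulrC.
have tV n : (n <= plen p)%N ->
    val (ptake p n) = (src a, traject (sigma Q) a n).
  move=> nl; rewrite /= epp /= -{1}(subnKC nl) trajectD.
  by rewrite take_size_cat // size_traject.
have dV n : (n <= plen p)%N -> val (pdrop p n) =
    (src (iter n (sigma Q) a), traject (sigma Q) (iter n (sigma Q) a) (plen p - n)).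
  move=> nl; rewrite /= epp /= -{1 2}(subnKC nl) trajectD.
  rewrite take_size_cat ?size_traject // drop_size_cat ?size_traject //.
  by rewrite last_traject.
have z1 : zelt (pdrop p j) = (plen p - j == zlen a)%N%:R.
  rewrite zeltE plen_drop; case: (ltnP j (plen p)) => jl'.
    by rewrite dV ?(ltnW jl') // -(subnSK jl') /= zlen_iter.
  have -> : (plen p - j = 0)%N by apply/eqP; rewrite subn_eq0.
  rewrite dV // (_ : plen p - j = 0)%N /=; last by apply/eqP; rewrite subn_eq0.
  by case: (zlen a) (zlen_gt0 a).
have z2 : zelt (ptake p (plen p - j)) = (plen p - j == zlen a)%N%:R.
  rewrite zeltE plen_take (minn_idPl (leq_subr _ _)) tV ?leq_subr //.
  case: (plen p - j)%N => [|n] //=.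
  by case: (zlen a) (zlen_gt0 a).
rewrite z1 z2; case: eqP => [e|]; last by rewrite !mulr0.
rewrite !mulr1; congr (x _); apply: val_inj.
rewrite tV // dV ?leq_subr // subKn // e.
by have := iter_norb a (val (m (orb a))); rewrite -/(zlen a) => ->.
Qed.

Lemma zeltX_eq0 i (p : qpath Q) : (plen p < i)%N -> (zelt ^+ i) p = 0.
Proof.
elim: i p => // i IH p; rewrite ltnS => pi.
rewrite exprS cmulE big_nat big1 // => j /andP[_ jl].
have [jp|pj] := ltnP j (plen p).
  by rewrite IH ?mulr0 // plen_take (minn_idPl (ltnW jp)) (leq_trans jp).
rewrite zeltE /= [drop _ _]drop_oversize ?mul0r //.
Qed.

(* The morphism k[[t]] -> completion k Q with t |-> z.  As z lies in the arrow
   ideal, z^i does not contribute to the coefficient of p for i > plen p. *)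
Definition ev (r : pseries k) : L :=
  fun p => \sum_(0 <= i < (plen p).+1) r i * (zelt ^+ i) p.

Lemma evE n r (p : qpath Q) : (plen p < n)%N ->
  ev r p = \sum_(0 <= i < n) r i * (zelt ^+ i) p.
Proof.
move=> pn; rewrite /ev [RHS](big_cat_nat _ pn) //= [X in _ + X]big_nat.
by rewrite [X in _ + X]big1 ?addr0 // => i /andP[pi _]; rewrite zeltX_eq0 ?mulr0.
Qed.

Fact ev_zmod : zmod_morphism ev.
Proof.
move=> r s; apply: funext => p; rewrite caddE coppE /ev -sumrB.
by apply: eq_bigr => i _; rewrite -mulrBl.
Qed.

Lemma evM r (x : L) (p : qpath Q) :
  (ev r * x) p = \sum_(0 <= i < (plen p).+1) r i * (zelt ^+ i * x) p.
Proof.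
under [RHS]eq_bigr => i _ do rewrite cmulE mulr_sumr.
rewrite exchange_big cmulE; apply: eq_big_nat => j _ /=.
rewrite (@evE (plen p).+1) ?plen_drop ?ltnS ?leq_subr // mulr_suml.
by apply: eq_bigr => i _; rewrite mulrA.
Qed.

Lemma Mev r (x : L) (p : qpath Q) :
  (x * ev r) p = \sum_(0 <= i < (plen p).+1) r i * (x * zelt ^+ i) p.
Proof.
under [RHS]eq_bigr => i _ do rewrite cmulE mulr_sumr.
rewrite exchange_big cmulE; apply: eq_big_nat => j _ /=.
rewrite (@evE (plen p).+1) ?plen_take ?ltnS ?geq_minr // mulr_sumr.
by apply: eq_bigr => i _; rewrite mulrCA.
Qed.

Fact ev_central r x : ev r * x = x * ev r.
Proof.
apply: funext => p; rewrite evM Mev; apply: eq_bigr => i _.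
by have /commr_sym/(commrX i)/commr_sym -> : GRing.comm zelt x := zelt_central x.
Qed.

Fact ev_monoid : monoid_morphism ev.
Proof.
split=> [|r s]; apply: funext => p.
  rewrite /ev big_nat_recl // big1 ?addr0 ?mul1r // => i _.
  by rewrite mul0r.
rewrite evM.
under [RHS]eq_big_nat => a /andP[_ al].
  rewrite Mev mulr_sumr.
  under eq_bigr => b _ do rewrite -exprD mulrA.
  have lp : ((plen p - a).+1 <= (plen p).+1)%N by rewrite ltnS leq_subr.
  rewrite (big_cat_nat (leq0n _) lp) /=.
  rewrite [X in _ + X]big_nat [X in _ + X]big1 ?addr0; last first.
    by move=> b /andP[ab _]; rewrite zeltX_eq0 ?mulr0 // -ltn_subLR.
over.
rewrite /=; transitivity (\sum_(0 <= c < (plen p).+1)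
    \sum_(0 <= a < c.+1) r a * s (c - a)%N * (zelt ^+ c) p).
  by apply: eq_bigr => c _; rewrite -mulr_suml.
rewrite sum_triangle; apply: eq_bigr => a _; apply: eq_bigr => b _.
by rewrite addKn.
Qed.

HB.instance Definition _ := GRing.isZmodMorphism.Build (pseries k) L ev ev_zmod.
HB.instance Definition _ :=
  GRing.isMonoidMorphism.Build (pseries k) L ev ev_monoid.

Definition order_algebra : algebra (pseries k) L := Algebra ev_central.

Definition brauer := cquot zelt_central.

HB.instance Definition _ := GRing.PzRing.on brauer.

Definition brauer_str (c : k) : brauer := cquot_pi zelt_central (cscal c).

Fact brauer_str_zmod : zmod_morphism brauer_str.
Proof.
move=> c d; rewrite /brauer_str -raddfB; congr cquot_pi.
by apply: funext => p; rewrite caddE coppE /cscal mulrBl.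
Qed.

Fact brauer_str_monoid : monoid_morphism brauer_str.
Proof.
split=> [|c d]; rewrite /brauer_str.
  rewrite -[RHS](rmorph1 (cquot_pi zelt_central)); congr cquot_pi.
  by apply: funext => p; rewrite /cscal mul1r.
rewrite -rmorphM; congr cquot_pi.
by apply: funext => p; rewrite cscalM /cscal mulrA.
Qed.

HB.instance Definition _ :=
  GRing.isZmodMorphism.Build k brauer brauer_str brauer_str_zmod.
HB.instance Definition _ :=
  GRing.isMonoidMorphism.Build k brauer brauer_str brauer_str_monoid.

Fact brauer_central c (x : brauer) : brauer_str c * x = x * brauer_str c.
Proof.
rewrite -[x]cquot_piK /brauer_str -!rmorphM; congr cquot_pi.
by apply: funext => p; rewrite cscalM cMscal.
Qed.

Definition brauer_algebra : algebra k brauer := Algebra brauer_central.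

End Brauer.

(* Categories whose morphisms are considered up to the equivalence [heq]. *)
Record category := Category {
  ob :> Type;
  hom : ob -> ob -> Type;
  heq : forall X Y, hom X Y -> hom X Y -> Prop;
  idm : forall X, hom X X;
  cmp : forall X Y Z, hom Y Z -> hom X Y -> hom X Z;
  heq_refl : forall X Y (f : hom X Y), heq f f;
  heq_sym : forall X Y (f g : hom X Y), heq f g -> heq g f;
  heq_trans : forall X Y (f g h : hom X Y), heq f g -> heq g h -> heq f h;
  cmp_eq : forall X Y Z (f f' : hom Y Z) (g g' : hom X Y),
    heq f f' -> heq g g' -> heq (cmp f g) (cmp f' g');
  cmpA : forall X Y Z W (f : hom Z W) (g : hom Y Z) (h : hom X Y),
    heq (cmp f (cmp g h)) (cmp (cmp f g) h);
  cmp1l : forall X Y (f : hom X Y), heq (cmp (idm Y) f) f;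
  cmp1r : forall X Y (f : hom X Y), heq (cmp f (idm X)) f }.
Arguments hom {c}.
Arguments heq {c X Y}.
Arguments idm {c}.
Arguments cmp {c X Y Z}.

Record functor (C D : category) := Functor {
  fob :> C -> D;
  fmap : forall X Y, hom X Y -> hom (fob X) (fob Y);
  fmap_eq : forall X Y (f g : hom X Y), heq f g -> heq (fmap f) (fmap g);
  fmap1 : forall X, heq (fmap (idm X)) (idm (fob X));
  fmapM : forall X Y Z (f : hom Y Z) (g : hom X Y),
    heq (fmap (cmp f g)) (cmp (fmap f) (fmap g)) }.
Arguments fmap {C D} _ {X Y}.

Definition functor_id (C : category) : functor C C.
Proof.
by exists (fun X => X) (fun X Y f => f) => // *; apply: heq_refl.
Defined.

Definition functor_cmp (C D E : category) (F : functor D E) (G : functor C D) :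
  functor C E.
Proof.
exists (fun X => F (G X)) (fun X Y f => fmap F (fmap G f)) => *.
- by do 2!apply: fmap_eq.
- by apply: heq_trans (fmap1 _ _); apply: fmap_eq; apply: fmap1.
- by apply: heq_trans (fmapM _ _ _); apply: fmap_eq; apply: fmapM.
Defined.

Record nat_trans (C D : category) (F G : functor C D) := NatTrans {
  ntc :> forall X, hom (F X) (G X);
  ntP : forall X Y (f : hom X Y),
    heq (cmp (ntc Y) (fmap F f)) (cmp (fmap G f) (ntc X)) }.

Definition nat_iso (C D : category) (F G : functor C D) : Prop :=
  exists (u : nat_trans F G) (v : nat_trans G F), forall X,
    heq (cmp (v X) (u X)) (idm (F X)) /\ heq (cmp (u X) (v X)) (idm (G X)).

(* The Gabriel-Zisman localisation of C at the class W: the morphisms are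
   composites of morphisms of C and formal inverses of morphisms in W, up to
   the evident relations. *)
Section Localisation.
Variables (C : category) (W : forall X Y : C, hom X Y -> Prop).

Inductive zigzag : C -> C -> Type :=
| ZMap X Y of hom X Y : zigzag X Y
| ZInv X Y (w : hom X Y) of W w : zigzag Y X
| ZCmp X Y Z of zigzag Y Z & zigzag X Y : zigzag X Z.

Inductive zeq : forall X Y, zigzag X Y -> zigzag X Y -> Prop :=
| zeq_refl X Y (f : zigzag X Y) : zeq f f
| zeq_sym X Y (f g : zigzag X Y) : zeq f g -> zeq g f
| zeq_trans X Y (f g h : zigzag X Y) : zeq f g -> zeq g h -> zeq f h
| zeq_cmp X Y Z (f f' : zigzag Y Z) (g g' : zigzag X Y) :
    zeq f f' -> zeq g g' -> zeq (ZCmp f g) (ZCmp f' g')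
| zeq_cmpA X Y Z V (f : zigzag Z V) (g : zigzag Y Z) (h : zigzag X Y) :
    zeq (ZCmp f (ZCmp g h)) (ZCmp (ZCmp f g) h)
| zeq_1l X Y (f : zigzag X Y) : zeq (ZCmp (ZMap (idm Y)) f) f
| zeq_1r X Y (f : zigzag X Y) : zeq (ZCmp f (ZMap (idm X))) f
| zeq_map X Y (f g : hom X Y) : heq f g -> zeq (ZMap f) (ZMap g)
| zeq_mapM X Y Z (f : hom Y Z) (g : hom X Y) :
    zeq (ZMap (cmp f g)) (ZCmp (ZMap f) (ZMap g))
| zeq_invl X Y (w : hom X Y) (Ww : W w) :
    zeq (ZCmp (ZInv Ww) (ZMap w)) (ZMap (idm X))
| zeq_invr X Y (w : hom X Y) (Ww : W w) :
    zeq (ZCmp (ZMap w) (ZInv Ww)) (ZMap (idm Y)).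

Definition localisation : category :=
  @Category C zigzag zeq (fun X => ZMap (idm X)) ZCmp
    zeq_refl zeq_sym zeq_trans zeq_cmp zeq_cmpA zeq_1l zeq_1r.

Definition loc_functor : functor C localisation :=
  @Functor C localisation (fun X => X) ZMap zeq_map
    (fun X => zeq_refl (ZMap (idm X))) zeq_mapM.

(* The functor induced on the localisation by a functor preserving W. *)
Section Induced.
Variables (F : functor C C)
  (FW : forall X Y (f : hom X Y), W f -> W (fmap F f)).

Fixpoint zmap X Y (f : zigzag X Y) : zigzag (F X) (F Y) :=
  match f with
  | ZMap _ _ f => ZMap (fmap F f)
  | ZInv _ _ _ Ww => ZInv (FW Ww)
  | ZCmp _ _ _ f g => ZCmp (zmap f) (zmap g)
  end.

Fact zmap_eq X Y (f g : zigzag X Y) : zeq f g -> zeq (zmap f) (zmap g).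
Proof.
have z1 U : zeq (ZMap (fmap F (idm U))) (ZMap (idm (F U))).
  by apply: zeq_map; apply: fmap1.
elim=> {X Y f g} //=.
- by move=> *; apply: zeq_refl.
- by move=> *; apply: zeq_sym.
- by move=> X Y f g h _ fg _; apply: zeq_trans.
- by move=> *; apply: zeq_cmp.
- by move=> *; apply: zeq_cmpA.
- move=> X Y f; apply: zeq_trans (zeq_1l _).
  by apply: zeq_cmp (z1 _) (zeq_refl _).
- move=> X Y f; apply: zeq_trans (zeq_1r _).
  by apply: zeq_cmp (zeq_refl _) (z1 _).
- by move=> *; apply: zeq_map; apply: fmap_eq.
- by move=> *; apply: zeq_trans (zeq_mapM _ _); apply: zeq_map; apply: fmapM.
- by move=> X Y w Ww; apply: zeq_trans (zeq_invl _) (zeq_sym (z1 _)).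
- by move=> X Y w Ww; apply: zeq_trans (zeq_invr _) (zeq_sym (z1 _)).
Qed.

Fact zmapM X Y Z (f : zigzag Y Z) (g : zigzag X Y) :
  zeq (zmap (ZCmp f g)) (ZCmp (zmap f) (zmap g)).
Proof. exact: zeq_refl. Qed.

Definition induced : functor localisation localisation :=
  @Functor localisation localisation (fun X : C => F X) zmap zmap_eq
    (fun X => zeq_map (fmap1 F X)) zmapM.

End Induced.

(* A total left derived functor of T: a right Kan extension of loc_functor \o T
   along loc_functor. *)
Record left_derived (T : functor C C) := LeftDerived {
  lfun :> functor localisation localisation;
  lcounit : nat_trans (functor_cmp lfun loc_functor) (functor_cmp loc_functor T);
  lfactor : forall (G : functor localisation localisation)
      (d : nat_trans (functor_cmp G loc_functor) (functor_cmp loc_functor T)),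
    exists u : nat_trans G lfun,
      (forall X : C, heq (cmp (lcounit X) (u X)) (d X)) /\
      (forall u' : nat_trans G lfun,
        (forall X : C, heq (cmp (lcounit X) (u' X)) (d X)) ->
        forall X, heq (u' X) (u X)) }.

End Localisation.

Section Tensor.
Variables (S : pzRingType) (M : bimod S).

(* M (x)_S X is the abelian group of formal sums of pairs (m, x), represented by
   lists, modulo the relations of the tensor product. *)
Inductive teq (X : lmodType S) : seq (M * X) -> seq (M * X) -> Prop :=
| teq_refl s : teq s s
| teq_sym s t : teq s t -> teq t s
| teq_trans s t u : teq s t -> teq t u -> teq s u
| teq_cat s s' t t' : teq s s' -> teq t t' -> teq (s ++ t) (s' ++ t')
| teq_catC s t : teq (s ++ t) (t ++ s)
| teq_0 x : teq [:: (0, x)] [::]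
| teq_Dl m n x : teq [:: (m + n, x)] [:: (m, x); (n, x)]
| teq_Dr m x y : teq [:: (m, x + y)] [:: (m, x); (m, y)]
| teq_bal m a x : teq [:: (ract m a, x)] [:: (m, a *: x)].

Lemma teq_map (X Y : lmodType S) (f : M -> M) (g : {linear X -> Y}) s t :
    (forall m n, f (m + n) = f m + f n) ->
    (forall m a, f (ract m a) = ract (f m) a) ->
  teq s t ->
  teq [seq (f q.1, g q.2) | q <- s] [seq (f q.1, g q.2) | q <- t].
Proof.
move=> fD fr; have f0 : f 0 = 0 by apply: (addrI (f 0)); rewrite -fD !addr0.
elim=> {s t} [s|s t _|s t u _ st _|s s' t t' _ IHs _ IHt|s t|x|m n x|m x y|m a x].
- exact: teq_refl.
- exact: teq_sym.
- exact: teq_trans st.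
- by rewrite !map_cat; apply: teq_cat.
- by rewrite !map_cat; apply: teq_catC.
- by rewrite /= f0; apply: teq_0.
- by rewrite /= fD; apply: teq_Dl.
- by rewrite /= raddfD; apply: teq_Dr.
- by rewrite /= fr linearZ; apply: teq_bal.
Qed.

Section TensorModule.
Variable X : lmodType S.

Definition teqb (s t : seq (M * X)) : bool := `[< teq s t >].

Fact teqb_equiv : equiv_class_of teqb.
Proof.
split=> [s|s t|t s u]; first by apply/asboolP; apply: teq_refl.
  by apply/asboolP/asboolP; apply: teq_sym.
by move=> /asboolP st /asboolP tu; apply/asboolP; apply: teq_trans st tu.
Qed.

Canonical teqb_rel := EquivRelPack teqb_equiv.
Canonical teqb_enc := defaultEncModRel teqb.

Definition tens := {eq_quot teqb}.

HB.instance Definition _ := Choice.on tens.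
HB.instance Definition _ := EqQuotient.on tens.

Definition tpi (s : seq (M * X)) : tens := \pi_tens s.

Lemma tpiP s t : tpi s = tpi t <-> teq s t.
Proof.
split=> [/eqP|e]; first by rewrite /tpi eqmodE => /asboolP.
by apply/eqP; rewrite /tpi eqmodE; apply/asboolP.
Qed.

Lemma tpiK (u : tens) : tpi (repr u) = u. Proof. exact: reprK. Qed.

Lemma tpi_repr s : teq (repr (tpi s)) s.
Proof. by apply/tpiP; rewrite tpiK. Qed.

Definition tadd (u v : tens) : tens := tpi (repr u ++ repr v).
Definition topp (u : tens) : tens := tpi [seq (- q.1, q.2) | q <- repr u].
Definition tzero : tens := tpi [::].
Definition tscale (a : S) (u : tens) : tens :=
  tpi [seq (lact a q.1, q.2) | q <- repr u].

Lemma tpi_cat s t : tpi (s ++ t) = tadd (tpi s) (tpi t).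
Proof. by apply/tpiP; apply: teq_sym; apply: teq_cat; apply: tpi_repr. Qed.

Fact taddA : associative tadd.
Proof.
by move=> u v w; rewrite -[u]tpiK -[v]tpiK -[w]tpiK -!tpi_cat catA.
Qed.
Fact taddC : commutative tadd.
Proof.
by move=> u v; rewrite -[u]tpiK -[v]tpiK -!tpi_cat; apply/tpiP/teq_catC.
Qed.
Fact tadd0 : left_id tzero tadd.
Proof. by move=> u; rewrite -[u]tpiK -tpi_cat. Qed.
Fact taddN : left_inverse tzero topp tadd.
Proof.
move=> u; rewrite -{2}[u]tpiK -tpi_cat; apply/tpiP.
elim: (repr u) => [|[m x] s IH] /=; first exact: teq_refl.
have e : teq [:: (- m, x); (m, x)] [::].
  by apply: teq_trans (teq_sym (teq_Dl _ _ _)) _; rewrite addNr; apply: teq_0.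
apply: teq_trans (teq_cat e IH); rewrite /=.
apply: (@teq_cat X [:: _] [:: _] _ _ (teq_refl _)).
rewrite -cat1s catA -[_ :: _ ++ _]/(([:: (m, x)] ++ _) ++ s).
exact: teq_cat (teq_catC _ _) (teq_refl _).
Qed.

HB.instance Definition _ := GRing.isZmodule.Build tens taddA taddC tadd0 taddN.

Lemma tpiD s t : tpi (s ++ t) = tpi s + tpi t. Proof. exact: tpi_cat. Qed.

Lemma tpi_scale a s : tscale a (tpi s) = tpi [seq (lact a q.1, q.2) | q <- s].
Proof.
apply/tpiP; apply: (@teq_map X X (lact a) idfun) (tpi_repr s) => [m n|m b].
  exact: lactDr.
by rewrite lractA.
Qed.

Fact tscaleA a b u : tscale a (tscale b u) = tscale (a * b) u.
Proof.
rewrite -[u]tpiK !tpi_scale -map_comp; congr tpi.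
by apply: eq_map => q /=; rewrite lactM.
Qed.
Fact tscale1 : left_id 1 tscale.
Proof.
move=> u; rewrite -[u]tpiK tpi_scale -[in RHS](map_id (repr u)); congr tpi.
by apply: eq_map => -[m x] /=; rewrite lact1.
Qed.
Fact tscaleDr : right_distributive tscale +%R.
Proof.
move=> a u v; rewrite -[u]tpiK -[v]tpiK -tpiD !tpi_scale.
by rewrite map_cat tpiD.
Qed.
Fact tscaleDl u : {morph tscale^~ u : a b / a + b}.
Proof.
move=> a b; rewrite -[u]tpiK !tpi_scale -tpiD; apply/tpiP.
elim: (repr u) => [|[m x] s IH] /=; first exact: teq_refl.
rewrite lactDl; apply: teq_trans (teq_cat (teq_Dl _ _ _) IH) _.
rewrite /=; apply: (@teq_cat X [:: _] [:: _] _ _ (teq_refl _)).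
rewrite -[_ :: _ ++ _]/(([:: (lact b m, x)] ++ _) ++ _) -[in X in teq _ X]cat1s.
rewrite [X in teq _ X]catA.
exact: teq_cat (teq_catC _ _) (teq_refl _).
Qed.

HB.instance Definition _ := GRing.Zmodule_isLmodule.Build S tens
  tscaleA tscale1 tscaleDr tscaleDl.

Lemma tpiZ a s : a *: tpi s = tpi [seq (lact a q.1, q.2) | q <- s].
Proof. exact: tpi_scale. Qed.

End TensorModule.

Section TensorMap.
Variables (X Y : lmodType S) (f : {linear X -> Y}).

Definition tmap (u : tens X) : tens Y := tpi [seq (q.1, f q.2) | q <- repr u].

Lemma tmap_pi s : tmap (tpi s) = tpi [seq (q.1, f q.2) | q <- s].
Proof. by apply/tpiP; apply: (@teq_map X Y id f) (tpi_repr s). Qed.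

Fact tmap_linear : linear tmap.
Proof.
move=> a u v; rewrite -[u]tpiK -[v]tpiK tpiZ -tpiD !tmap_pi tpiZ -tpiD.
by rewrite map_cat -!map_comp.
Qed.

HB.instance Definition _ := GRing.isLinear.Build S (tens X) (tens Y) _ tmap tmap_linear.

End TensorMap.
End Tensor.

Definition fin_gen (S : pzRingType) (X : lmodType S) : Prop :=
  exists (n : nat) (g : 'I_n -> X),
    forall x, exists c : 'I_n -> S, x = \sum_i c i *: g i.

Definition bimod_fin_gen (S : pzRingType) (M : bimod S) : Prop :=
  exists (n : nat) (g : 'I_n -> M),
    forall x, exists c : 'I_n -> S, x = \sum_i lact (c i) (g i).

Section TensorFinGen.
Variables (S : pzRingType) (M : bimod S) (X : lmodType S).
Implicit Types (m : M) (x : X).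

Definition tpure m x : tens M X := tpi [:: (m, x)].

Lemma tpureDl m n x : tpure (m + n) x = tpure m x + tpure n x.
Proof. by rewrite -tpiD; apply/tpiP/teq_Dl. Qed.
Lemma tpureDr m x y : tpure m (x + y) = tpure m x + tpure m y.
Proof. by rewrite -tpiD; apply/tpiP/teq_Dr. Qed.
Lemma tpure0l x : tpure 0 x = 0.
Proof. by apply/tpiP/teq_0. Qed.
Lemma tpure0r m : tpure m 0 = 0.
Proof. by apply: (addrI (tpure m 0)); rewrite -tpureDr !addr0. Qed.
Lemma tpure_bal m a x : tpure (ract m a) x = tpure m (a *: x).
Proof. by apply/tpiP/teq_bal. Qed.
Lemma tpureZ a m x : tpure (lact a m) x = a *: tpure m x.
Proof. by rewrite tpiZ. Qed.
Lemma tpi_sum s : tpi s = \sum_(q <- s) tpure q.1 q.2 :> tens M X.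
Proof.
elim: s => [|[m x] s IH]; first by rewrite big_nil.
by rewrite big_cons -cat1s tpiD IH.
Qed.

Lemma tens_fin_gen : bimod_fin_gen M -> fin_gen X -> fin_gen (tens M X).
Proof.
move=> [n [g gP]] [l [h hP]].
pose G (q : 'I_n * 'I_l) := tpure (g q.1) (h q.2).
pose ok u := exists c : 'I_n * 'I_l -> S, u = \sum_q c q *: G q.
have ok0 : ok 0 by exists (fun _ => 0); rewrite big1 // => q _; rewrite scale0r.
have okD u v : ok u -> ok v -> ok (u + v).
  move=> [c ->] [d ->]; exists (fun q => c q + d q).
  by rewrite -big_split; apply: eq_bigr => q _; rewrite scalerDl.
have okZ a u : ok u -> ok (a *: u).
  move=> [c ->]; exists (fun q => a * c q).
  by rewrite scaler_sumr; apply: eq_bigr => q _; rewrite scalerA.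
have okG q : ok (G q).
  exists (fun q' => (q' == q)%:R); rewrite (bigD1 q) //= eqxx scale1r big1 ?addr0 //.
  by move=> q' /negPf ->; rewrite scale0r.
have okh m j : ok (tpure m (h j)).
  have [c ->] := gP m; elim/big_ind: _ => [|m1 m2|i _].
  - by rewrite tpure0l.
  - by rewrite tpureDl; apply: okD.
  - by rewrite tpureZ; apply/okZ/(okG (i, j)).
have okp m x : ok (tpure m x).
  have [c ->] := hP x; elim/big_ind: _ => [|x1 x2|j _].
  - by rewrite tpure0r.
  - by rewrite tpureDr; apply: okD.
  - by rewrite -tpure_bal; apply: okh.
exists #|{: 'I_n * 'I_l}|, (fun i => G (enum_val i)) => u.
have [c ->] : ok u.
  rewrite -[u]tpiK tpi_sum; elim: (repr u) => [|[m x] s IH].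
    by rewrite big_nil.
  by rewrite big_cons; apply: okD.
exists (fun i => c (enum_val i)); rewrite (reindex_onto enum_val enum_rank) /=.
  by apply: eq_bigl => i; rewrite enum_valK eqxx.
by move=> q _; rewrite enum_rankK.
Qed.

End TensorFinGen.

Section Complexes.
Variable S : pzRingType.

(* Bounded above cochain complexes of finitely generated left S-modules. *)
Record complex := Complex {
  cob :> int -> lmodType S;
  cdiff : forall i, {linear cob i -> cob (i + 1)};
  cdiffK : forall i x, cdiff (i + 1) (cdiff i x) = 0;
  c_fin_gen : forall i, fin_gen (cob i);
  c_bounded : exists N : int, forall i, (N < i)%R -> forall x : cob i, x = 0 }.

Record chain_map (X Y : complex) := ChainMap {
  cmap :> forall i, {linear X i -> Y i};
  cmapP : forall i x, cmap (i + 1) (cdiff X i x) = cdiff Y i (cmap i x) }.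

Definition chain_eq X Y (f g : chain_map X Y) : Prop := forall i x, f i x = g i x.

Definition chain_id X : chain_map X X.
Proof. by exists (fun i => idfun : {linear X i -> X i}). Defined.

Definition chain_cmp X Y Z (f : chain_map Y Z) (g : chain_map X Y) : chain_map X Z.
Proof.
by exists (fun i => f i \o g i : {linear X i -> Z i}) => i x /=; rewrite !cmapP.
Defined.

Definition Ch : category.
Proof.
apply: (@Category complex chain_map chain_eq chain_id chain_cmp) => //.
- by move=> X Y f g e i x; rewrite e.
- by move=> X Y f g h e e' i x; rewrite e e'.
- by move=> X Y Z f f' g g' e e' i x /=; rewrite e' e.
Defined.

(* Every integer is of the form i + 1, so this says that f induces bijections
   on all cohomology modules. *)
Definition quasi_iso (X Y : Ch) (f : hom X Y) : Prop := forall i : int,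
  (forall x : X (i + 1), cdiff X (i + 1) x = 0 ->
    (exists y : Y i, f (i + 1) x = cdiff Y i y) ->
    exists x' : X i, x = cdiff X i x') /\
  (forall y : Y (i + 1), cdiff Y (i + 1) y = 0 ->
    exists x : X (i + 1), cdiff X (i + 1) x = 0 /\
      exists y' : Y i, y = f (i + 1) x + cdiff Y i y').

(* D^-(mod S), obtained by inverting the quasi-isomorphisms. *)
Definition Dminus : category := localisation quasi_iso.

(* X[1]^i = X^(i+1), with differential - d. *)
Definition shift_ob (X : complex) : complex.
Proof.
exists (fun i => X (i + 1)) (fun i => \- cdiff X (i + 1) : {linear _ -> _}).
- by move=> i x /=; rewrite linearN opprK cdiffK.
- by move=> i; apply: c_fin_gen.
- have [N NP] := c_bounded X; exists N => i Ni; apply: NP.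
  by rewrite (lt_trans Ni) // ltrDl.
Defined.

Definition shift_map X Y (f : chain_map X Y) :
  chain_map (shift_ob X) (shift_ob Y).
Proof.
by exists (fun i => f (i + 1)) => i x /=; rewrite linearN cmapP.
Defined.

Definition shift_functor : functor Ch Ch.
Proof.
exists (shift_ob : Ch -> Ch) shift_map.
- by move=> X Y f g e i x; apply: e.
- by move=> X i x.
- by move=> X Y Z f g i x.
Defined.

Lemma shift_quasi_iso X Y (f : hom X Y) :
  quasi_iso f -> quasi_iso (fmap shift_functor f).
Proof.
move=> qf i; have [inj surj] := qf (i + 1); split=> /=.
  move=> x dx [y fy]; have [||x' ->] := inj x.
  - by apply: oppr_inj; rewrite oppr0; apply: dx.
  - by exists (- y); rewrite linearN.
  - by exists (- x'); rewrite /= linearN opprK.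
move=> y dy; have [|x [dx [y' ->]]] := surj y.
  by apply: oppr_inj; rewrite oppr0; apply: dy.
exists x; split; first by rewrite /= dx oppr0.
by exists (- y'); rewrite linearN opprK.
Qed.

Definition shift : functor Dminus Dminus := induced shift_quasi_iso.

Section TensorComplex.
Variables (M : bimod S) (Mfg : bimod_fin_gen M).

Definition tens_ob (X : complex) : complex.
Proof.
exists (fun i => tens M (X i)) 
  (fun i => tmap (cdiff X i) : {linear tens M (X i) -> tens M (X (i + 1))}).
- move=> i u /=; rewrite -[u]tpiK !tmap_pi -map_comp tpi_sum big_map big1 // => q _.
  by rewrite /= cdiffK tpure0r.
- by move=> i; apply: tens_fin_gen (c_fin_gen X i).
- have [N NP] := c_bounded X; exists N => i Ni u.
  rewrite -[u]tpiK tpi_sum big1 // => q _.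
  by rewrite (NP i Ni q.2) tpure0r.
Defined.

Definition tens_map X Y (f : chain_map X Y) : chain_map (tens_ob X) (tens_ob Y).
Proof.
exists (fun i => tmap (f i) : {linear tens M (X i) -> tens M (Y i)}) => i u /=.
rewrite -[u]tpiK !tmap_pi -!map_comp; congr tpi.
by apply: eq_map => q /=; rewrite cmapP.
Defined.

Definition tens_functor : functor Ch Ch.
Proof.
exists (tens_ob : Ch -> Ch) tens_map.
- move=> X Y f g e i u /=; rewrite -[u]tpiK !tmap_pi; congr tpi.
  by apply: eq_map => q /=; rewrite e.
- move=> X i u /=; rewrite -[u in RHS]tpiK -[u]tpiK tmap_pi; congr tpi.
  by rewrite tpiK -[RHS]map_id; apply: eq_map => -[].
- move=> X Y Z f g i u /=; rewrite -[u]tpiK !tmap_pi -map_comp; congr tpi.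
Defined.

Definition derived_tensor := left_derived quasi_iso tens_functor.

End TensorComplex.

End Complexes.

Section Nakayama.
Variables (K : comPzRingType) (S : pzRingType) (al : algebra K S).

(* The derived Nakayama functor nu = Hom_K(S, K) (x)^L_S - on D^-(mod S); [fg]
   ensures that Hom_K(S, K) (x)_S - preserves finitely generated modules. *)
Definition nakayama (fg : bimod_fin_gen (dual_bimod al)) := derived_tensor fg.

(* The functor S is nu o [1] for an order and nu for an algebra over a field. *)
Definition serre_order fg (nu : nakayama fg) := functor_cmp nu (@shift S).
Definition serre_alg fg (nu : nakayama fg) : functor (Dminus S) (Dminus S) := nu.

Definition nakayama_iso_id : Prop :=
  exists fg (nu : nakayama fg), nat_iso nu (functor_id (Dminus S)).

Definition serre_order_iso_shift : Prop :=
  exists fg (nu : nakayama fg), nat_iso (serre_order nu) (@shift S).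

Definition serre_alg_iso_id : Prop :=
  exists fg (nu : nakayama fg), nat_iso (serre_alg nu) (functor_id (Dminus S)).

End Nakayama.

(* Main.v *)
Require Import Defs.
From HB Require Import structures.
From mathcomp Require Import all_boot all_order all_fingroup all_algebra.
From mathcomp Require Import generic_quotient boolp.
Import GRing.Theory.
Local Open Scope ring_scope.

Set Implicit Arguments.
Unset Strict Implicit.
Unset Printing Implicit Defensive.

(* Call an algebra S over K Frobenius if Hom_K(S, K) is free of
   rank one as a right module.  Then Hom_K(S, K) (x)_S - is exact, so the Nakayama
   functor nu is induced by it on D^-(mod S).  If Hom_K(S, K) = S as bimodules, nu
   is the identity.  Conversely, an isomorphism nu o [1] = [1], evaluated on the
   stalk complex S[1], gives in cohomology a left linear bijection
   S -> Hom_K(S, K), which is right linear by naturality with respect to the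
   endomorphisms x |-> x b of S.

   Choose signs eps on the arrows, opposite on the two arrows
   starting at a vertex.  Then tau(x) = sum_n t^n sum_b eps(b) x(c_b^(m (n+1))),
   where x(p) is the coefficient of p in x, is R-linear because
   z e_i = c_b^m + c_d^m for the two arrows b, d starting at i, and a |-> tau(a -)
   is bijective onto the dual of Lambda.  If eps is constant on sigma-orbits (eps = 1
   in characteristic two, eps = the sign of a 2-colouring of the graph otherwise)
   then tau(xy) = tau(yx), so Lambda is symmetric.  Functionals on A lift to Lambda,
   so a symmetrizing form on Lambda reduces to one on A.  Finally, a symmetrizing
   form f on A takes at c_b^m a nonzero value g(b) with g(sigma b) = g(b) and
   g(d) = - g(b) for the two arrows b, d starting at a vertex; outside characteristic two,
   choosing one element of each pair {u, - u} turns g into a 2-colouring. *)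

Local Notation hom := Defs.hom.
Local Notation idm := Defs.idm.
Local Notation ract := Defs.ract.

(** * Localisations and derived functors *)

Section NatIso.

Lemma nat_iso_sym (C D : category) (F G : functor C D) :
  nat_iso F G -> nat_iso G F.
Proof. by case=> u [v uv]; exists v, u => X; have [] := uv X. Qed.

Lemma cmp_cancel (C : category) (X Y Z : C) (f : hom Y Z) (g : hom Z Y)
    (f' : hom X Y) (g' : hom Y X) :
    heq (cmp g f) (idm Y) -> heq (cmp g' f') (idm X) ->
  heq (cmp (cmp g' g) (cmp f f')) (idm X).
Proof.
move=> gf gf'; apply: heq_trans gf'.
apply: heq_trans (heq_sym (cmpA _ _ _)) _.
apply: cmp_eq (heq_refl _) _.
apply: heq_trans (cmpA _ _ _) _.
exact: heq_trans (cmp_eq gf (heq_refl _)) (cmp1l _).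
Qed.

Definition nat_cmp (C D : category) (F G H : functor C D)
  (v : nat_trans G H) (u : nat_trans F G) : nat_trans F H.
Proof.
exists (fun X => cmp (v X) (u X)) => X Y f.
apply: heq_trans (heq_sym (cmpA _ _ _)) _.
apply: heq_trans (cmp_eq (heq_refl _) (ntP u f)) _.
apply: heq_trans (cmpA _ _ _) _.
apply: heq_trans (cmp_eq (ntP v f) (heq_refl _)) _.
exact: heq_sym (cmpA _ _ _).
Defined.

Definition nat_id (C D : category) (F : functor C D) : nat_trans F F.
Proof.
exists (fun X => idm (F X)) => X Y f.
exact: heq_trans (cmp1l _) (heq_sym (cmp1r _)).
Defined.

Lemma nat_iso_trans (C D : category) (F G H : functor C D) :
  nat_iso F G -> nat_iso G H -> nat_iso F H.
Proof.
move=> [u [v uv]] [u' [v' uv']]; exists (nat_cmp u' u), (nat_cmp v v') => X.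
by have [[a b] [c d]] := (uv X, uv' X); split; apply: cmp_cancel.
Qed.

Lemma nat_iso_whisker (C D E : category) (F G : functor D E) (H : functor C D) :
  nat_iso F G -> nat_iso (functor_cmp F H) (functor_cmp G H).
Proof.
move=> [u [v uv]].
pose u' : nat_trans (functor_cmp F H) (functor_cmp G H) :=
  @NatTrans _ _ (functor_cmp F H) (functor_cmp G H)
    (fun X => u (H X)) (fun X Y f => ntP u (fmap H f)).
pose v' : nat_trans (functor_cmp G H) (functor_cmp F H) :=
  @NatTrans _ _ (functor_cmp G H) (functor_cmp F H)
    (fun X => v (H X)) (fun X Y f => ntP v (fmap H f)).
by exists u', v' => X; apply: uv.
Qed.

Lemma nat_iso_cmp_id (C D : category) (F : functor C D) :
  nat_iso (functor_cmp (functor_id D) F) F.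
Proof.
pose u : nat_trans (functor_cmp (functor_id D) F) F :=
  @NatTrans _ _ (functor_cmp (functor_id D) F) F _ (ntP (nat_id F)).
pose v : nat_trans F (functor_cmp (functor_id D) F) :=
  @NatTrans _ _ F (functor_cmp (functor_id D) F) _ (ntP (nat_id F)).
by exists u, v => X; split; apply: cmp1l.
Qed.

End NatIso.

Section LocalisedFunctors.
Variables (C : category) (W : forall X Y : C, hom X Y -> Prop).
Local Notation D := (localisation W).

(** The square for a formal inverse of [w] is the square for [w] composed with the inverses of [F w]
    and [G w], and composites paste squares. So naturality need only be tested on morphisms of
    [C]. *)
Lemma zigzag_natural (E : category) (F G : functor D E)
    (c : forall X : C, hom (F X) (G X)) :
    (forall (X Y : C) (f : hom X Y), heq (cmp (c Y) (fmap F (ZMap W f : @hom D X Y)))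
       (cmp (fmap G (ZMap W f : @hom D X Y)) (c X))) ->
  forall (X Y : D) (f : hom X Y), heq (cmp (c Y) (fmap F f)) (cmp (fmap G f) (c X)).
Proof.
move=> cM X Y f; elim: f => {X Y} [X Y f|X Y w Ww|X Y Z f IHf g IHg].
- exact: cM.
- have F1 : heq (cmp (fmap F (ZMap W w : @hom D X Y))
      (fmap F (ZInv Ww : @hom D Y X))) (idm _).
    apply: heq_trans (heq_sym (fmapM _ _ _)) _; apply: heq_trans (fmap1 _ _).
    exact/fmap_eq/zeq_invr.
  have G1 : heq (cmp (fmap G (ZInv Ww : @hom D Y X))
      (fmap G (ZMap W w : @hom D X Y))) (idm _).
    apply: heq_trans (heq_sym (fmapM _ _ _)) _; apply: heq_trans (fmap1 _ _).
    exact/fmap_eq/zeq_invl.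
  apply: heq_trans (heq_sym (cmp1l _)) _.
  apply: heq_trans (cmp_eq (heq_sym G1) (heq_refl _)) _.
  apply: heq_trans (heq_sym (cmpA _ _ _)) _; apply: cmp_eq (heq_refl _) _.
  apply: heq_trans (cmpA _ _ _) _.
  apply: heq_trans (cmp_eq (heq_sym (cM _ _ w)) (heq_refl _)) _.
  apply: heq_trans (heq_sym (cmpA _ _ _)) _.
  exact: heq_trans (cmp_eq (heq_refl _) F1) (cmp1r _).
- apply: heq_trans (cmp_eq (heq_refl _) (fmapM F _ _)) _.
  apply: heq_trans (cmpA _ _ _) _.
  apply: heq_trans (cmp_eq IHf (heq_refl _)) _.
  apply: heq_trans (heq_sym (cmpA _ _ _)) _.
  apply: heq_trans (cmp_eq (heq_refl _) IHg) _.
  apply: heq_trans (cmpA _ _ _) _.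
  exact: cmp_eq (heq_sym (fmapM G _ _)) (heq_refl _).
Qed.

Variables (T : functor C C) (TW : forall X Y (f : hom X Y), W f -> W (fmap T f)).

(** As [T] preserves [W], the induced functor restricts to [T] itself. The counit is the identity,
    and a transformation [d] is its own factorisation. *)
Definition induced_left_derived : left_derived W T.
Proof.
pose c : nat_trans (functor_cmp (induced TW) (loc_functor W))
    (functor_cmp (loc_functor W) T) :=
  @NatTrans _ _ (functor_cmp (induced TW) (loc_functor W))
    (functor_cmp (loc_functor W) T)
    (fun X => idm (T X : D))
    (fun X Y f => heq_trans (cmp1l (fmap (functor_cmp (loc_functor W) T) f))
       (heq_sym (cmp1r _))).
exists (induced TW) c => G d.
exists (NatTrans (zigzag_natural (F := G) (G := induced TW) (ntP d))).
split=> [X|u' cu' X] /=.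
  exact: zeq_1l.
exact: heq_trans (heq_sym (cmp1l _)) (cu' X).
Defined.

(** The counit of [nu] is the isomorphism, and the universal property of [nu] supplies [u] in the
    other direction. The composite of [c] and [u] and the identity both factor the counit through
    itself, hence agree. *)
Lemma left_derived_iso_induced (nu : left_derived W T) :
  nat_iso nu (induced TW).
Proof.
have cN := zigzag_natural (F := nu) (G := induced TW) (ntP (lcounit nu)).
pose c : nat_trans nu (induced TW) := NatTrans cN.
have [u [cu _]] := lfactor nu (lcounit induced_left_derived).
have [w [_ wU]] := lfactor nu (lcounit nu).
exists c, u => X; split; last exact: cu.
have e : heq (nat_cmp u c X) (w X).
  apply: wU => Y; apply: zeq_trans (zeq_cmpA _ _ _) _.
  exact: zeq_trans (zeq_cmp (cu Y) (zeq_refl _)) (zeq_1l _).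
have e' : heq (nat_id nu X) (w X) by apply: wU => Y; apply: zeq_1r.
exact: heq_trans e (heq_sym e').
Qed.

End LocalisedFunctors.

(** * Tensoring with a bimodule that is free of rank one on the right *)

Section RankOneTensor.
Variables (S : pzRingType) (M : bimod S) (m0 : M) (g : M -> S).
Hypotheses (g_can : cancel (ract m0) g) (can_g : cancel g (ract m0)).

Lemma ract_coordD m n : g (m + n) = g m + g n.
Proof. by rewrite -[m in LHS]can_g -[n in LHS]can_g -ractDr g_can. Qed.

Lemma ract_coordM m a : g (ract m a) = g m * a.
Proof. by rewrite -[m in LHS]can_g -ractM g_can. Qed.

(** Right linearity of [g] makes the sum compatible with every generating relation, so it defines a
    map on the tensor product; this map will invert [tpure m0]. *)
Lemma teq_coord (X : lmodType S) (s t : seq (M * X)) : teq s t ->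
  \sum_(q <- s) g q.1 *: q.2 = \sum_(q <- t) g q.1 *: q.2.
Proof.
elim=> {s t} [//|//|s t u _ -> _ ->//|s s' t t' _ es _ et|s t|x|m n x|m x y|m a x].
- by rewrite !big_cat es et.
- by rewrite !big_cat /= addrC.
- have g0 : g 0 = 0 by apply: (addrI (g 0)); rewrite -ract_coordD !addr0.
  by rewrite big_seq1 big_nil g0 scale0r.
- by rewrite !big_cons big_nil !addr0 ract_coordD scalerDl.
- by rewrite !big_cons big_nil !addr0 scalerDr.
- by rewrite !big_seq1 ract_coordM scalerA.
Qed.

Definition tcoord (X : lmodType S) (u : tens M X) : X :=
  \sum_(q <- repr u) g q.1 *: q.2.

Lemma tcoord_pi (X : lmodType S) (s : seq (M * X)) :
  tcoord (tpi s) = \sum_(q <- s) g q.1 *: q.2.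
Proof. exact: teq_coord (tpi_repr s). Qed.

Lemma tpureK (X : lmodType S) : cancel (@tpure S M X m0) (@tcoord X).
Proof.
move=> x; rewrite /tpure tcoord_pi big_seq1 /=.
have -> : g m0 = 1 by rewrite -[m0 in LHS]ract1 g_can.
exact: scale1r.
Qed.

Lemma tcoordK (X : lmodType S) : cancel (@tcoord X) (@tpure S M X m0).
Proof.
move=> u; rewrite /tcoord -[RHS]tpiK tpi_sum.
elim/big_rec2: _ => [|q y x _ <-]; first by rewrite tpure0r.
by rewrite tpureDr -tpure_bal can_g.
Qed.

Lemma tmap_tpure (X Y : lmodType S) (f : {linear X -> Y}) m x :
  tmap f (tpure (m : M) x) = tpure m (f x).
Proof. exact: tmap_pi. Qed.

Variable Mfg : bimod_fin_gen M.

(** The additive bijections [tpure m0] commute with differentials and chain maps, and the two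
    conditions of a quasi-isomorphism concern only the underlying groups. *)
Lemma tens_quasi_iso (X Y : Ch S) (f : hom X Y) :
  quasi_iso f -> quasi_iso (fmap (tens_functor Mfg) f).
Proof.
move=> qf i; have [inj surj] := qf i.
pose th (Z : lmodType S) := @tpure S M Z m0.
have th_inj (Z : lmodType S) : injective (th Z) := can_inj (@tpureK Z).
split=> /= [u du [v fu]|v dv].
- rewrite -[u]tcoordK in du fu *; rewrite -[v]tcoordK in fu.
  rewrite !tmap_tpure in du fu.
  have [||x' ->] := inj (tcoord u).
  + by apply: th_inj; rewrite /th tpure0r.
  + by exists (tcoord v); apply: th_inj.
  + by exists (tpure m0 x'); rewrite tmap_tpure.
- rewrite -[v]tcoordK in dv *; rewrite tmap_tpure in dv.
  have [|x [dx [y' ->]]] := surj (tcoord v).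
    by apply: th_inj; rewrite /th tpure0r.
  exists (tpure m0 x); split; first by rewrite tmap_tpure dx tpure0r.
  by exists (tpure m0 y'); rewrite !tmap_tpure tpureDr.
Qed.

(** The canonical isomorphism from M tensor S to M. It is computed on a chosen representative;
    [tens_unit_pi] shows that any other gives the same value. *)
Definition tens_unit (u : tens M S^o) : M := \sum_(q <- repr u) ract q.1 q.2.

Lemma tens_unitE u : tens_unit u = ract m0 (tcoord u).
Proof.
rewrite /tens_unit /tcoord; elim/big_rec2: _ => [|q y x _ ->].
  by apply: (addrI (ract m0 0)); rewrite -ractDr !addr0.
by rewrite ractDr ractM can_g.
Qed.

Lemma tens_unit_pi s : tens_unit (tpi s) = \sum_(q <- s) ract q.1 q.2.
Proof.
rewrite tens_unitE tcoord_pi; elim/big_rec2: _ => [|q y x _ <-].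
  by apply: (addrI (ract m0 0)); rewrite -ractDr !addr0.
by rewrite ractDr ractM can_g.
Qed.

Lemma tens_unit_bij : bijective tens_unit.
Proof.
apply: eq_bij (fun u => esym (tens_unitE u)).
apply: (bij_comp (f := ract m0)); first by exists g.
exists (@tpure S M S^o m0); [exact: tcoordK|exact: tpureK].
Qed.

Lemma tens_unitD u v : tens_unit (u + v) = tens_unit u + tens_unit v.
Proof. by rewrite -[u]tpiK -[v]tpiK -tpiD !tens_unit_pi big_cat. Qed.

Lemma tens_unitZ a u : tens_unit (a *: u) = lact a (tens_unit u).
Proof.
rewrite -[u]tpiK tpiZ !tens_unit_pi big_map /=.
elim/big_rec2: _ => [|q y x _ ->]; last by rewrite lactDr lractA.
by apply: (addrI (lact a 0)); rewrite -lactDr !addr0.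
Qed.

Lemma tens_unitM (r : {linear S^o -> S^o}) (b : S) u : (forall x : S, r x = x * b) ->
  tens_unit (tmap r u) = ract (tens_unit u) b.
Proof.
move=> rE; rewrite -[u]tpiK tmap_pi !tens_unit_pi big_map /=.
elim/big_rec2: _ => [|q y x _ ->]; last by rewrite ractDl rE ractM.
by apply: (addrI (ract 0 b)); rewrite -ractDl !addr0.
Qed.

End RankOneTensor.

Section DerivedTensor.
Variables (S : pzRingType) (M : bimod S) (Mfg : bimod_fin_gen M).
Variables (m0 : M) (g : M -> S).
Hypotheses (g_can : cancel (ract m0) g) (can_g : cancel g (ract m0)).

Definition Dtens : functor (Dminus S) (Dminus S) :=
  induced (tens_quasi_iso g_can can_g Mfg).

Lemma derived_tensor_iso (nu : derived_tensor Mfg) : nat_iso nu Dtens.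
Proof. exact: left_derived_iso_induced. Qed.

Hypothesis m0C : forall a, lact a m0 = ract m0 a.

(** Since [m0] commutes with scalars, [a] moves from [x] across the tensor sign to the right of
    [m0], and then to its left. *)
Lemma tpure_linear (X : lmodType S) : linear (@tpure S M X m0).
Proof. by move=> a x y; rewrite tpureDr -tpure_bal -m0C tpureZ. Qed.

Lemma tcoord_linear (X : lmodType S) : linear (@tcoord S M g X).
Proof.
move=> a u v; rewrite -[u](tcoordK can_g) -[v](tcoordK can_g).
by rewrite -tpure_linear !(tpureK g_can can_g).
Qed.

Definition tpure_chain (X : complex S) : chain_map X (tens_ob Mfg X).
Proof.
pose B i := GRing.isLinear.Build S (X i) (tens M (X i)) _ _ (@tpure_linear (X i)).
exists (fun i =>
  HB.pack_for {linear X i -> tens M (X i)} (@tpure S M (X i) m0) (B i)) => i x /=.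
by rewrite tmap_tpure.
Defined.

Definition tcoord_chain (X : complex S) : chain_map (tens_ob Mfg X) X.
Proof.
pose B i := GRing.isLinear.Build S (tens M (X i)) (X i) _ _ (@tcoord_linear (X i)).
exists (fun i =>
  HB.pack_for {linear tens M (X i) -> X i} (@tcoord S M g (X i)) (B i)) => i u /=.
by rewrite -[u](tcoordK can_g) tmap_tpure !(tpureK g_can can_g).
Defined.

(** [tpure_chain] and [tcoord_chain] are inverse chain maps, natural for chain maps and hence, by
    [zigzag_natural], for all zigzags. *)
Lemma Dtens_iso_id : nat_iso Dtens (functor_id (Dminus S)).
Proof.
pose c (X : Ch S) : @hom (Dminus S) X (tens_ob Mfg X) :=
  ZMap (@quasi_iso S) (tpure_chain X : @hom (Ch S) _ _).
pose d (X : Ch S) : @hom (Dminus S) (tens_ob Mfg X) X :=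
  ZMap (@quasi_iso S) (tcoord_chain X : @hom (Ch S) _ _).
have cN := @zigzag_natural (Ch S) (@quasi_iso S) (Dminus S) (functor_id _) Dtens c.
have dN := @zigzag_natural (Ch S) (@quasi_iso S) (Dminus S) Dtens (functor_id _) d.
have cM (X Y : Ch S) (f : hom X Y) :
    heq (cmp (c Y) (ZMap (@quasi_iso S) f : @hom (Dminus S) X Y))
    (cmp (ZMap (@quasi_iso S) (fmap (tens_functor Mfg) f) : @hom (Dminus S) _ _) (c X)).
  apply: zeq_trans (zeq_sym (zeq_mapM _ _ _)) _.
  apply: zeq_trans (zeq_mapM _ _ _); apply: zeq_map => i x /=.
  by rewrite tmap_tpure.
have dM (X Y : Ch S) (f : hom X Y) :
    heq (cmp (d Y) (ZMap (@quasi_iso S) (fmap (tens_functor Mfg) f) : @hom (Dminus S) _ _))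
        (cmp (ZMap (@quasi_iso S) f : @hom (Dminus S) X Y) (d X)).
  apply: zeq_trans (zeq_sym (zeq_mapM _ _ _)) _.
  apply: zeq_trans (zeq_mapM _ _ _); apply: zeq_map => i u /=.
  by rewrite -[u](tcoordK can_g) tmap_tpure !(tpureK g_can can_g).
exists (NatTrans (dN dM)), (NatTrans (cN cM)) => X; split.
  apply: zeq_trans (zeq_sym (zeq_mapM _ _ _)) _; apply: zeq_map => i u /=.
  exact: tcoordK.
apply: zeq_trans (zeq_sym (zeq_mapM _ _ _)) _; apply: zeq_map => i u /=.
exact: tpureK.
Qed.

End DerivedTensor.

(** * Cohomology of morphisms of the derived category *)

Section Cohomology.
Variables (S : pzRingType) (i : int).
Local Notation Z := (@zigzag (Ch S) (@quasi_iso S)).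

(* The additive relation between cocycles of degree i + 1 that a morphism of
   D^-(mod S) induces on cohomology. *)
Fixpoint hrel (X Y : Ch S) (f : Z X Y) : X (i + 1) -> Y (i + 1) -> Prop :=
  match f in zigzag _ X Y return X (i + 1) -> Y (i + 1) -> Prop with
  | ZMap X Y f => fun x y =>
      cdiff X (i + 1) x = 0 /\ exists y', y = f (i + 1) x + cdiff Y i y'
  | ZInv X Y f _ => fun y x =>
      cdiff X (i + 1) x = 0 /\ exists y', y = f (i + 1) x + cdiff Y i y'
  | ZCmp X Y V f g => fun x v => exists y, hrel g x y /\ hrel f y v
  end.

Lemma hrel_cocycle (X Y : Ch S) (f : Z X Y) x y : hrel f x y ->
  cdiff X (i + 1) x = 0 /\ cdiff Y (i + 1) y = 0.
Proof.
have mapZ (U V : Ch S) (h : hom U V) u v' : cdiff U (i + 1) u = 0 ->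
    cdiff V (i + 1) (h (i + 1) u + cdiff V i v') = 0.
  by move=> du; rewrite linearD cdiffK addr0 -cmapP du linear0.
elim: f x y => {X Y} [X Y f|X Y w Ww|X Y V f IHf g IHg] x y /=.
- by case=> dx [y' ->]; split=> //; apply: mapZ.
- by case=> dx [y' ->]; split=> //; apply: mapZ.
- by case=> v [/IHg[-> _] /IHf[_ ->]].
Qed.

(** For a formal inverse this is surjectivity of a quasi-isomorphism on cohomology. *)
Lemma hrel_total (X Y : Ch S) (f : Z X Y) x :
  cdiff X (i + 1) x = 0 -> exists y, hrel f x y.
Proof.
elim: f x => {X Y} [X Y f|X Y w Ww|X Y V f IHf g IHg] x dx /=.
- by exists (f (i + 1) x); split=> //; exists 0; rewrite linear0 addr0.
- have [_ surj] := Ww i; have [u [du [y' ->]]] := surj x dx.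
  by exists u; split=> //; exists y'.
- have [y gxy] := IHg x dx; have [_ dy] := hrel_cocycle gxy.
  by have [v fyv] := IHf y dy; exists v, y.
Qed.

Lemma hrel_linear (X Y : Ch S) (f : Z X Y) a x y x' y' :
  hrel f x y -> hrel f x' y' -> hrel f (a *: x + x') (a *: y + y').
Proof.
have mapL (U V : Ch S) (h : hom U V) u v u' v' :
    cdiff U (i + 1) u = 0 /\ (exists w, v = h (i + 1) u + cdiff V i w) ->
    cdiff U (i + 1) u' = 0 /\ (exists w, v' = h (i + 1) u' + cdiff V i w) ->
    cdiff U (i + 1) (a *: u + u') = 0 /\
      exists w, a *: v + v' = h (i + 1) (a *: u + u') + cdiff V i w.
  move=> [du [w ->]] [du' [w' ->]]; split.
    by rewrite linearP du du' scaler0 addr0.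
  by exists (a *: w + w'); rewrite !linearP scalerDr addrACA.
elim: f x y x' y' => {X Y} [X Y f|X Y w Ww|X Y V f IHf g IHg] x y x' y' /=.
- exact: mapL.
- exact: mapL.
- move=> [u [xu uy]] [u' [xu' uy']].
  by exists (a *: u + u'); split; [apply: IHg|apply: IHf].
Qed.

Lemma hrel_boundary (X Y : Ch S) (f : Z X Y) x y x' y' :
  hrel f x y -> hrel f (x + cdiff X i x') (y + cdiff Y i y').
Proof.
have mapB (U V : Ch S) (h : hom U V) u v u' v' :
    cdiff U (i + 1) u = 0 /\ (exists w, v = h (i + 1) u + cdiff V i w) ->
    cdiff U (i + 1) (u + cdiff U i u') = 0 /\
      exists w, v + cdiff V i v' = h (i + 1) (u + cdiff U i u') + cdiff V i w.
  move=> [du [w ->]]; split; first by rewrite linearD du cdiffK addr0.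
  exists (w + v' - h i u'); rewrite !linearD linearN -cmapP.
  by rewrite -!addrA; congr (_ + _); rewrite [RHS]addrC -!addrA addNr addr0.
elim: f x y x' y' => {X Y} [X Y f|X Y w Ww|X Y V f IHf g IHg] x y x' y' /=.
- exact: mapB.
- exact: mapB.
- move=> [u [/IHg xu /IHf uy]]; exists (u + cdiff Y i 0); split; first exact: xu.
  exact: uy.
Qed.

(** With [hrel_linear], this makes the relation single-valued up to boundaries. For a formal inverse
    it is injectivity on cohomology. *)
Lemma hrel_functional (X Y : Ch S) (f : Z X Y) x y :
  hrel f (cdiff X i x) y -> exists y', y = cdiff Y i y'.
Proof.
elim: f x y => {X Y} [X Y f|X Y w Ww|X Y V f IHf g IHg] x y /=.
- by case=> _ [y' ->]; exists (f i x + y'); rewrite linearD cmapP.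
- case=> dy [y' e]; have [inj _] := Ww i; apply: inj => //.
  exists (x - y'); rewrite linearB e addrK //.
- by case=> u [/IHg[u' ->] /IHf].
Qed.

(** Induction over the generating relations. The two cancellation laws of a formal inverse rest on
    injectivity and surjectivity on cohomology; the unit laws hold because [hrel] absorbs
    boundaries. *)
Lemma hrel_eq (X Y : Ch S) (f g : Z X Y) :
  zeq f g -> forall x y, hrel f x y <-> hrel g x y.
Proof.
have id1 (U : Ch S) (u : U (i + 1)) : u = u + cdiff U i 0.
  by rewrite linear0 addr0.
elim=> {X Y f g} [//|X Y f g _ IH x y|X Y f g h _ IH _ IH' x y
  |X Y V f f' g g' _ IHf _ IHg x y|X Y V U f g h x y|X Y f x y|X Y f x y
  |X Y f g fg x y|X Y V f g x y|X Y w Ww x y|X Y w Ww x y].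
- by rewrite IH.
- by rewrite IH.
- by split=> -[u [xu uy]]; exists u; split; [apply/IHg|apply/IHf|apply/IHg|apply/IHf].
- split=> /=.
    by move=> [v [[u [xu uv]] vy]]; exists u; split=> //; exists v.
  by move=> [u [xu [v [uv vy]]]]; exists v; split=> //; exists u.
- split=> /= [[u [xu [_ [y' ->]]]]|xy].
    by rewrite [x]id1; apply: hrel_boundary.
  have [_ dy] := hrel_cocycle xy; exists y; split=> //; split=> //.
  by exists 0; apply: id1.
- split=> /= [[u [[dx [x' ->]] xy]]|xy].
    have := hrel_boundary (- x') 0 xy.
    by rewrite linearN addrK linear0 addr0.
  have [dx _] := hrel_cocycle xy; exists x; split=> //; split=> //.
  by exists 0; apply: id1.
- by rewrite /= fg.
- split=> /= [[dx [v ->]]|[u [[dx [u' ->]] [_ [v ->]]]]].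
    exists (g (i + 1) x); split; first by split=> //; exists 0; apply: id1.
    split; last by exists v.
    by rewrite -cmapP dx linear0.
  split=> //; exists (f i u' + v).
  by rewrite !linearD cmapP addrA.
- split=> /= [[u [[dx [u' ->]] [dy [v e]]]]|[dx [x' ->]]].
    split=> //; have [inj _] := Ww i.
    have [||z ez] := inj (y - x).
    + by rewrite linearB dx dy subr0.
    + exists (u' - v); rewrite !linearB; apply/eqP.
      by rewrite subr_eq addrAC eq_sym subr_eq -e addrC.
    + by exists z; rewrite -ez (addrC x) subrK.
  exists (w (i + 1) x); split; first by split=> //; exists 0; apply: id1.
  split; first by rewrite linearD dx cdiffK addr0.
  by exists (- w i x'); rewrite linearD linearN cmapP addrK.
- split=> /= [[u [[du [x' ->]] [_ [y' ->]]]]|[dx [y' ->]]].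
    split; first by rewrite linearD cdiffK addr0 -cmapP du linear0.
    by exists (y' - x'); rewrite linearB -addrA; congr (_ + _); rewrite addrCA subrr addr0.
  have [_ surj] := Ww i; have [u [du [v e]]] := surj x dx.
  exists u; split; first by split=> //; exists v.
  by split=> //; exists (v + y'); rewrite e linearD addrA.
Qed.

End Cohomology.

(** * Stalk complexes, and symmetry read off from the Nakayama functor *)

Section Stalk.
Variable S : pzRingType.

(** Matching on the integer lets degree 0 reduce to [S^o] by computation; row vectors of length 0
    serve as the zero module. *)
Definition stalk_ob (i : int) : lmodType S :=
  if i is Posz 0 then S^o else 'rV[S]_0.

Definition stalk : complex S.
Proof.
exists stalk_ob (fun i => \0 : {linear stalk_ob i -> stalk_ob (i + 1)}) => //.
  case=> [[|n]|n].
  - by exists 1%N, (fun _ => (1 : S^o)) => x; exists (fun _ => x); rewrite big_ord1 [RHS]mulr1.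
  - by exists 0%N, (fun _ => 0) => x; exists (fun _ => 0); rewrite big_ord0 [LHS]thinmx0.
  - by exists 0%N, (fun _ => 0) => x; exists (fun _ => 0); rewrite big_ord0 [LHS]thinmx0.
by exists 0 => -[[|n]|n] //= _ x; rewrite [x]thinmx0.
Defined.

Variable b : S.

Definition rmul (x : S^o) : S^o := (x : S) * b.

Fact rmul_linear : linear rmul.
Proof. by move=> a x y; rewrite /rmul mulrDl -mulrA. Qed.
HB.instance Definition _ := GRing.isLinear.Build S S^o S^o _ rmul rmul_linear.

Definition stalk_rmul : chain_map stalk stalk.
Proof.
exists (fun i => match i return {linear stalk_ob i -> stalk_ob i} with
  | Posz 0 => rmul | _ => idfun end) => i x.
by rewrite linear0.
Defined.

End Stalk.

Section NakayamaEquivalences.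
Variables (K : comPzRingType) (S : pzRingType) (al : algebra K S).

Lemma symmetric_nakayama : symmetric_alg al -> nakayama_iso_id al.
Proof.
move=> [f [[g gK Kg] fD fl fr]].
(* [f 1] is a free right generator of the dual on which the left and right actions agree, as
   [Dtens_iso_id] requires. *)
have fE a : f a = ract (f 1) a by rewrite -fr /= mul1r.
have fC a : lact a (f 1) = ract (f 1) a by rewrite -fE -fl /= mulr1.
have g_can : cancel (ract (f 1)) g by move=> a; rewrite -fE gK.
have can_g : cancel g (ract (f 1)) by move=> a; rewrite -fE Kg.
have fg : bimod_fin_gen (dual_bimod al).
  exists 1%N, (fun _ => f 1) => x; exists (fun _ => g x).
  by rewrite big_ord1 fC can_g.
exists fg, (induced_left_derived (tens_quasi_iso g_can can_g fg)).
exact: Dtens_iso_id g_can can_g fC.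
Qed.

Lemma nakayama_serre_order :
  nakayama_iso_id al -> serre_order_iso_shift al.
Proof.
move=> [fg [nu nu1]]; exists fg, nu.
exact: nat_iso_trans (nat_iso_whisker _ nu1) (nat_iso_cmp_id _).
Qed.

Lemma serre_order_symmetric (m0 : dual_bimod al) : bijective (ract m0) ->
  serre_order_iso_shift al -> symmetric_alg al.
Proof.
move=> [g g_can can_g] [fg [nu nu1]].
have nuD := derived_tensor_iso g_can can_g nu.
have := nat_iso_trans (nat_iso_sym (nat_iso_whisker (@shift S) nuD)) nu1.
move=> {nu nu1 nuD} [u [v uv]].
pose st : Ch S := stalk S.
(* X = S[1] lives in degree -1 = Negz 1 + 1. *)
pose X : Ch S := shift_ob st; pose Y : Ch S := tens_ob fg X.
pose U : zigzag (@quasi_iso S) Y X := u st.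
pose V : zigzag (@quasi_iso S) X Y := v st.
have [VU UV] := uv st.
(* All differentials vanish, so every element is a cocycle and 0 is the only boundary: [hrel]
   becomes the graph of an actual map. *)
have dX i x : cdiff X i x = 0 by rewrite /= oppr0.
have dY i y : cdiff Y i y = 0.
  by rewrite -[y](tcoordK can_g) /= tmap_tpure /= oppr0 tpure0r.
pose h (x : S) (y : tens (dual_bimod al) S^o) := hrel (i := Negz 1) V x y.
pose h' (y : tens (dual_bimod al) S^o) (x : S) := hrel (i := Negz 1) U y x.
have hL a x x' y y' : h x y -> h x' y' -> h (a * x + x') (a *: y + y').
  exact: hrel_linear.
have h0 y : h 0 y -> y = 0.
  move=> hy; have [|z ->] := @hrel_functional S (Negz 1) X Y V 0 y; last exact: (dY (Negz 1) z).
  by rewrite dX.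
have h0' x : h' 0 x -> x = 0.
  move=> hx; have [|z ->] := @hrel_functional S (Negz 1) Y X U 0 x; last exact: (dX (Negz 1) z).
  by rewrite dY.
have hU x y y' : h x y -> h x y' -> y = y'.
  move=> hy hy'; have /h0 : h 0 (-1 *: y + y').
    by have := hL (-1) _ _ _ _ hy hy'; rewrite mulN1r addNr.
  by rewrite scaleN1r addrC => /subr0_eq ->.
have hT x : exists y, h x y := @hrel_total S (Negz 1) X Y V x (dX (Negz 1 + 1) x).
have hT' y : exists x, h' y x := @hrel_total S (Negz 1) Y X U y (dY (Negz 1 + 1) y).
have hUV x y x' : h x y -> h' y x' -> x' = x.
  move=> xy yx; have /(hrel_eq (i := Negz 1) UV)[_ [z ->]] :
    hrel (i := Negz 1) (ZCmp U V) x x' by exists y.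
  by rewrite dX addr0.
have hVU y x y' : h' y x -> h x y' -> y' = y.
  move=> xy yx; have /(hrel_eq (i := Negz 1) VU)[_ [z ->]] :
    hrel (i := Negz 1) (ZCmp V U) y y' by exists x.
  by rewrite dY addr0.
(* Naturality of [v] along right multiplication by [b], the source of right linearity. *)
have hM b x y : h x y -> h (x * b) (tmap (rmul b) y).
  move=> xy; have [y' xby'] := hT (x * b).
  have N := ntP v (ZMap (@quasi_iso S) (stalk_rmul b : @hom (Ch S) st st)).
  have /(hrel_eq (i := Negz 1) N)[y1 [xy1 [_ [z ey]]]] : hrel (i := Negz 1)
      (ZCmp V (ZMap (@quasi_iso S) (shift_map (stalk_rmul b) : @hom (Ch S) _ _))) x y'.
    exists (x * b); split=> //; split; first exact: dX.
    by exists 0; rewrite dX addr0.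
  by rewrite -(hU _ _ _ xy1 xy) -[tmap _ _]addr0 -(dY _ z) -[X in h _ X]ey.
have [F hF] := choice hT; have [G hG] := choice hT'.
have FD x x' : F (x + x') = F x + F x'.
  have := hL 1 _ _ _ _ (hF x) (hF x'); rewrite mul1r scale1r => e.
  exact: hU (hF _) e.
exists (fun x => tens_unit (F x)); split=> [|x y|a x|x a].
- apply: bij_comp (tens_unit_bij g_can can_g) _.
  exists G => [x|y]; first exact: hUV (hF x) (hG _).
  exact: hVU (hG y) (hF _).
- by rewrite FD (tens_unitD g_can can_g).
- rewrite -(tens_unitZ g_can can_g); congr tens_unit.
  have := hL a _ _ _ _ (hF x) (hF 0); rewrite (h0 _ (hF 0)) !addr0 => e.
  exact: hU (hF _) e.
- rewrite -(tens_unitM g_can can_g (r := rmul a)) //; congr tens_unit.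
  exact: hU (hF _) (hM _ _ _ (hF x)).
Qed.

End NakayamaEquivalences.

(** * Lambda as a k[[t]]-module *)

Section PathBasis.
Variables (k : fieldType) (Q : gentle_quiver) (m : multiplicity Q).
Local Notation L := (completion k Q).
Local Notation s := (sigma Q).
Local Notation Z := (zlen m).
Local Notation z := (zelt k m).
Implicit Types (b c : arrow Q) (x y : L) (j l n : nat).

Lemma pth_nz b l : nz_path (src b, traject s b l).
Proof.
case: l => // l; rewrite /nz_path /= eqxx /=.
apply: sub_path (fpath_traject s b l) => a c /eqP <-.
by rewrite sigmaP.
Qed.

(** A path outside I follows [sigma] from its first arrow, so pairs [(b, l)] parametrise the basis.
    At [l = 0] only [src b] matters: both arrows at a vertex give the same trivial path. *)
Definition pth b l : qpath Q := exist (fun p => nz_path p) _ (pth_nz b l).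

Lemma plen_pth b l : plen (pth b l) = l.
Proof. exact: size_traject. Qed.

Lemma src_arrow (i : vertex Q) : exists b, src b == i.
Proof.
have /eqP/cards2P[b [c [_ e]]] := two_out (gentleP Q) i.
by exists b; have := set21 b c; rewrite -e inE.
Qed.

Definition arrow_at (i : vertex Q) : arrow Q := xchoose (src_arrow i).

Lemma src_arrow_at i : src (arrow_at i) = i.
Proof. exact/eqP/(xchooseP (src_arrow i)). Qed.

Lemma pth0 b c : src b = src c -> pth b 0 = pth c 0.
Proof. by move=> e; apply: val_inj; rewrite /= e. Qed.

Lemma qpath_pth (p : qpath Q) : exists b, p = pth b (plen p).
Proof.
case ep: (val p).2 => [|b t]; last first.
  by exists b; apply: val_inj; rewrite (qpath_traject ep).
exists (arrow_at (val p).1); apply: val_inj.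
by rewrite [LHS]surjective_pairing ep /plen ep /= src_arrow_at.
Qed.

Lemma pth_ext x y : (forall b l, x (pth b l) = y (pth b l)) -> x = y.
Proof. by move=> e; apply: funext => p; have [b ->] := qpath_pth p. Qed.

Lemma pth_eq b l c j :
  (pth b l == pth c j) = (l == j) && (if j is 0 then src b == src c else b == c).
Proof.
apply/eqP/andP => [e|[/eqP <-]].
  have := congr1 (@plen Q) e; rewrite !plen_pth => <-; split=> //.
  move/(congr1 val): e => [-> e]; case: l j e => [|l] [|j] //= [->] //.
by case: l => [/eqP/pth0|l /eqP ->].
Qed.

Lemma cmul_pth x y b l : (x * y) (pth b l) =
  \sum_(0 <= j < l.+1) x (pth (iter j s b) (l - j)) * y (pth b j).
Proof.
rewrite cmulE plen_pth; apply: eq_big_nat => j /andP[_]; rewrite ltnS => jl.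
have tE : take j (traject s b l) = traject s b j.
  by rewrite -{1}(subnKC jl) trajectD take_size_cat ?size_traject.
have dE : drop j (traject s b l) = traject s (iter j s b) (l - j).
  by rewrite -{1}(subnKC jl) trajectD drop_size_cat ?size_traject.
by congr (x _ * y _); apply: val_inj; rewrite /= tE ?Defs.last_traject ?dE.
Qed.

Definition mpath b l : L := mono k (src b) (traject s b l).

Lemma mpathE b l c j : mpath b l (pth c j) = (pth c j == pth b l)%:R.
Proof. by rewrite -val_eqE. Qed.

Lemma mpathM b j l : mpath (iter j s b) l * mpath b j = mpath b (j + l).
Proof. by rewrite /mpath mono_cat ?Defs.last_traject // trajectD. Qed.

Lemma mul_mpath0 x b c l : (x * mpath b 0) (pth c l) =
  if src c == src b then x (pth c l) else 0.
Proof.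
rewrite cmul_pth big_nat_recl //= subn0 big1 ?addr0 => [|j _].
  by rewrite mpathE pth_eq eqxx /=; case: eqP => _; rewrite ?mulr1 ?mulr0.
by rewrite mpathE pth_eq mulr0.
Qed.

Lemma mul_mpath x b j c l : (0 < j)%N -> (x * mpath b j) (pth c l) =
  if (c == b) && (j <= l)%N then x (pth (iter j s b) (l - j)) else 0.
Proof.
case: j => // j _; rewrite cmul_pth.
under eq_bigr => i _ do rewrite mpathE pth_eq.
have [->|cb] /= := eqVneq c b; last first.
  by rewrite big1 // => i _; rewrite andbF mulr0.
case: (leqP j.+1 l) => jl.
  rewrite (bigD1_seq j.+1) ?mem_index_iota ?iota_uniq //= eqxx mulr1.
  by rewrite big1 ?addr0 // => i /negPf ->; rewrite mulr0.
rewrite big_nat big1 // => i /andP[_ il].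
by case: eqP => [e|]; rewrite ?mulr0 //; move: il; rewrite ltnS e leqNgt jl.
Qed.

Lemma mpath_mul x b j c l : (mpath b j * x) (pth c l) =
  if (j <= l)%N && (pth (iter (l - j) s c) j == pth b j) then x (pth c (l - j)) else 0.
Proof.
rewrite cmul_pth; under eq_bigr => i _ do rewrite mpathE.
case: (leqP j l) => jl /=.
  rewrite (bigD1_seq (l - j)%N) ?mem_index_iota ?iota_uniq ?ltnS ?leq_subr //= subKn //.
  rewrite big_nat_cond big1 ?addr0; first by case: eqP; rewrite ?mul1r ?mul0r.
  move=> i /andP[/andP[_ il] /eqP ij]; rewrite ltnS in il.
  case: (_ =P pth b j) => [/(congr1 (@plen Q))|]; last by rewrite mul0r.
  by rewrite !plen_pth => e; case: ij; rewrite -e subKn.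
rewrite big_nat big1 // => i /andP[_ il].
case: (_ =P pth b j) => [/(congr1 (@plen Q))|]; last by rewrite mul0r.
by rewrite !plen_pth => e; move: jl; rewrite -e ltnNge leq_subr.
Qed.

Lemma iter_zlen b n : iter (Z b * n) s b = b.
Proof. by rewrite /zlen -mulnA iter_norb. Qed.

Lemma iter_zlen1 b : iter (Z b) s b = b.
Proof. by rewrite -[Z b]muln1 iter_zlen. Qed.

Lemma zelt_pth b l : z (pth b l) = (l == Z b)%:R.
Proof.
rewrite zeltE plen_pth; case: l => [|l] //=.
by rewrite eq_sym eqn0Ngt zlen_gt0.
Qed.

(** The only initial segment of [pth b l] in the support of [z] is the cycle of length [Z b], and
    removing it leads back to the arrow [b]. *)
Lemma zelt_mul x b l :
  (z * x) (pth b l) = if (Z b <= l)%N then x (pth b (l - Z b)) else 0.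
Proof.
rewrite zelt_central cmul_pth.
under eq_bigr => j _ do rewrite zelt_pth.
case: leqP => Zl.
  rewrite (bigD1_seq (Z b)) ?mem_index_iota ?iota_uniq //= eqxx mulr1 iter_zlen1.
  by rewrite big1 ?addr0 // => j /negPf ->; rewrite mulr0.
rewrite big_nat big1 // => j /andP[_ jl].
by case: eqP => [e|]; rewrite ?mulr0 //; move: jl; rewrite ltnS e leqNgt Zl.
Qed.

Lemma zelt_mpath b j : (0 < j)%N -> z * mpath b j = mpath b (j + Z b).
Proof.
case: j => // j _; apply: pth_ext => c l.
rewrite zelt_mul !mpathE !pth_eq addSn /=.
have [->|cb] := eqVneq c b; last by rewrite !andbF if_same.
rewrite !andbT -addSn; case: leqP => Zl.
  by rewrite -(eqn_add2r (Z b) (l - _)) subnK.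
by rewrite ltn_eqF // (leq_trans Zl) // leq_addl.
Qed.

Lemma zelt_vertex (i : vertex Q) :
  z * mono k i [::] = \sum_(b : arrow Q | src b == i) mpath b (Z b).
Proof.
apply: pth_ext => c l; rewrite -(src_arrow_at i) -/(mpath (arrow_at i) 0).
rewrite src_arrow_at mul_mpath0 csumE src_arrow_at zelt_pth.
under eq_bigr => b _ do rewrite mpathE pth_eq.
have zE b : (if Z b is 0 then src c == src b else c == b) = (c == b).
  by case: (Z b) (zlen_gt0 m b).
under eq_bigr => b _ do rewrite zE.
case: eqP => [ci|ci].
  rewrite (bigD1 c) ?ci //= eqxx andbT big1 ?addr0 // => b /andP[_].
  by rewrite eq_sym => /negPf ->; rewrite andbF.
rewrite big1 // => b /eqP bi; case: (eqVneq c b) => [e|]; last by rewrite andbF.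
by case: ci; rewrite e.
Qed.

(* The coefficients of z x at the two powers c_c^m(v_c) starting at a vertex agree,
   so reading off one of them gives a left inverse of multiplication by z. *)
Definition divz x : L := fun p =>
  if (val p).2 is c :: _ then x (pth c (plen p + Z c))
  else let c := arrow_at (val p).1 in x (pth c (Z c)).

Lemma divz_pth x b l : divz x (pth b l) =
  let c := if l is 0 then arrow_at (src b) else b in x (pth c (l + Z c)).
Proof. by rewrite /divz plen_pth /=; case: l. Qed.

Lemma divzK x : divz (z * x) = x.
Proof.
apply: pth_ext => b l; rewrite divz_pth; case: l => [|l] /=.
  by rewrite zelt_mul leqnn subnn (pth0 (src_arrow_at _)).
by rewrite zelt_mul leq_addl addnK.
Qed.

Lemma divzD x y : divz (x + y) = divz x + divz y.
Proof. by apply: pth_ext => b l; rewrite caddE !divz_pth. Qed.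

Lemma divzZ (a : k) x : divz (cscal a * x) = cscal a * divz x.
Proof. by apply: pth_ext => b l; rewrite cscalM !divz_pth /= cscalM. Qed.

Lemma short_ind (K : L -> Prop) x :
    K 0 -> (forall x y, K x -> K y -> K (x + y)) ->
    (forall a x, K x -> K (cscal a * x)) ->
    (forall b l, (l <= Z b)%N -> K (mpath b l)) ->
    (forall b l, (Z b < l)%N -> x (pth b l) = 0) ->
  K x.
Proof.
move=> K0 KD KZ KP x0.
(* Trivial paths are indexed by vertices to count each once; the others by first arrow and length
   from 1 to [Z b]. *)
have -> : x = \sum_(i : vertex Q) cscal (x (pth (arrow_at i) 0)) * mpath (arrow_at i) 0
    + \sum_(b : arrow Q) \sum_(0 <= l < Z b) cscal (x (pth b l.+1)) * mpath b l.+1.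
  apply: pth_ext => c j; rewrite caddE !csumE.
  under eq_bigr => i _ do rewrite cscalM mpathE pth_eq src_arrow_at.
  under [X in _ + X]eq_bigr => b _.
    rewrite csumE; under eq_bigr => l _ do rewrite cscalM mpathE pth_eq /=.
  over.
  case: j => [|j] /=.
    rewrite (bigD1 (src c)) //= eqxx mulr1 (pth0 (src_arrow_at _)).
    rewrite big1 ?addr0 => [|i]; last by rewrite eq_sym => /negPf ->; rewrite mulr0.
    rewrite big1 ?addr0 // => b _; rewrite big1 // => l _; by rewrite mulr0.
  rewrite big1 ?add0r => [|i _]; last by rewrite mulr0.
  rewrite (bigD1 c) //= [X in _ + X]big1 ?addr0; last first.
    move=> b bc; rewrite big1 // => l _.
    by rewrite eq_sym in bc; rewrite (negPf bc) andbF mulr0.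
  case: (ltnP j (Z c)) => jZ.
    rewrite (bigD1_seq j) ?mem_index_iota ?iota_uniq //= !eqxx mulr1.
    rewrite big1 ?addr0 // => l lj; rewrite eqSS eq_sym.
    by rewrite (negPf lj) mulr0.
  rewrite x0 // big_nat big1 // => l /andP[_ lZ]; rewrite eqSS.
  by case: eqP => [e|]; rewrite ?mulr0 //; rewrite -e ltnNge jZ in lZ.
apply: (KD); first by elim/big_ind: _ => // i _; apply/KZ/KP.
elim/big_ind: _ => // b _; rewrite big_nat.
by elim/big_ind: _ => // l /andP[_ lZ]; apply/KZ/KP.
Qed.

(** The short paths span Lambda modulo [z]: at length [l > Z b] the coefficients of [x] and
    [z * divz x] agree, because [l - Z b > 0] makes [divz] read along [b] and not along
    [arrow_at]. *)
Lemma span_mod_zelt (K : L -> Prop) :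
    K 0 -> (forall x y, K x -> K y -> K (x + y)) ->
    (forall a x, K x -> K (cscal a * x)) ->
    (forall b l, (l <= Z b)%N -> K (mpath b l)) ->
  forall x, K (x - z * divz x).
Proof.
move=> K0 KD KZ KP x; apply: short_ind => // b l Zl.
rewrite caddE coppE zelt_mul (ltnW Zl) divz_pth.
by rewrite -[X in if X is 0 then _ else _](subnSK Zl) /= subnK ?subrr // ltnW.
Qed.

End PathBasis.

Lemma inj_surj_bij (S T : Type) (f : S -> T) :
  injective f -> (forall y, exists x, f x = y) -> bijective f.
Proof. by move=> fi /choice[g fg]; exists g => // x; apply: fi; apply: fg. Qed.

(** * The duals of Lambda and A *)

Section ScalarExtension.
Variables (k : fieldType) (Q : gentle_quiver) (m : multiplicity Q).
Local Notation L := (completion k Q).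
Local Notation R := (pseries k).
Local Notation z := (zelt k m).
Local Notation Lambda := (order_algebra k m).
Local Notation A := (brauer_algebra k m).
Implicit Types (x y : L) (r : R) (n : nat).

Definition bpi x : brauer k m := cquot_pi (@zelt_central k Q m) x.
Local Notation pi := bpi.

Lemma bpiD x y : pi (x + y) = pi x + pi y. Proof. exact: cquot_piD. Qed.
Lemma bpi0 : pi 0 = 0. Proof. by apply: (addrI (pi 0)); rewrite -bpiD !addr0. Qed.
Lemma bpiM x y : pi (x * y) = pi x * pi y. Proof. exact: cquot_piM. Qed.
Lemma bpiZ (a : k) x : pi (cscal a * x) = A a * pi x. Proof. exact: bpiM. Qed.
Lemma bpiK (u : brauer k m) : pi (repr u) = u. Proof. exact: cquot_piK. Qed.
Lemma bpiP x y : pi x = pi y <-> exists w, x - y = z * w.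
Proof. exact: cquot_piP. Qed.

Lemma psaddE r r' n : (r + r') n = r n + r' n. Proof. by []. Qed.

(** The power series a + t r. *)
Definition pscons (a : k) r : R := fun n => if n is n'.+1 then r n' else a.

Lemma pscons_eta r : r = pscons (r 0%N) (fun n => r n.+1).
Proof. by apply: funext; case. Qed.

Lemma psmul_cons a r r' n :
  (pscons a r * r') n = a * r' n + if n is n'.+1 then (r * r') n' else 0.
Proof.
rewrite [LHS]big_nat_recl //= subn0; congr (_ + _).
by case: n => [|n]; [rewrite big_nil|apply: eq_bigr => i _; rewrite subSS].
Qed.

Lemma ev_cons a r : ev m (pscons a r) = cscal a + z * ev m r.
Proof.
apply: funext => p; rewrite caddE -ev_central evM [LHS]big_nat_recl //=.
congr (_ + _); rewrite [RHS]big_nat_recr //= -exprSr zeltX_eq0 // mulr0 addr0.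
by apply: eq_bigr => i _; rewrite -exprSr.
Qed.

Section MakeDual.
Variable f : L -> R.
Hypotheses (fD : forall x y, f (x + y) = f x + f y)
  (fZ : forall (a : k) x n, f (cscal a * x) n = a * f x n)
  (fz : forall x n, f (z * x) n = if n is n'.+1 then f x n' else 0).

(** No continuity argument is required: the n-th coefficient involves finitely many coefficients of
    [r], and induction on n splits [r] as a + t r'. *)
Fact mkdual_scale (r : R) x : f (Lambda r * x) = r * f x.
Proof.
apply: funext => n; rewrite /=; elim: n r => [|n IH] r;
  by rewrite (pscons_eta r) ev_cons mulrDl fD psaddE fZ -mulrA fz psmul_cons ?IH.
Qed.

Definition mkdual : dual Lambda := Dual fD mkdual_scale.

End MakeDual.

Lemma order_dualZ (phi : dual Lambda) (a : k) x n :
  dfun phi (cscal a * x) n = a * dfun phi x n.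
Proof.
have -> : cscal a = ev m (pscons a 0) by rewrite ev_cons rmorph0 mulr0 addr0.
by rewrite (dualZ phi) psmul_cons mul0r; case: n => [|n]; rewrite addr0.
Qed.

Lemma order_dual_zelt (phi : dual Lambda) x n :
  dfun phi (z * x) n = if n is n'.+1 then dfun phi x n' else 0.
Proof.
have -> : z = ev m (pscons 0 1).
  rewrite ev_cons rmorph1 mulr1 (_ : cscal 0 = 0) ?add0r //.
  by apply: funext => p; rewrite /cscal mul0r.
by rewrite (dualZ phi) psmul_cons mul0r add0r mul1r.
Qed.

(** Induction on the coefficient: [x - z * divz x] is a combination of short paths, and coefficient
    n + 1 on [z * divz x] is coefficient n on [divz x]. *)
Lemma order_dual_ext (phi psi : dual Lambda) :
    (forall b l, (l <= zlen m b)%N -> dfun phi (mpath k b l) = dfun psi (mpath k b l)) ->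
  phi = psi.
Proof.
move=> e; apply: dual_eq => x; apply: funext => n.
have dual0 (f : dual Lambda) : dfun f 0 = 0.
  by apply: (addrI (dfun f 0)); rewrite -dualD !addr0.
have eK u : dfun phi (u - z * divz m u) = dfun psi (u - z * divz m u).
  apply: (span_mod_zelt (K := fun u => dfun phi u = dfun psi u)) => //.
  - by rewrite !dual0.
  - by move=> v w ev ew; rewrite !dualD ev ew.
  - by move=> a v ev; apply: funext => j; rewrite !order_dualZ ev.
elim: n x => [|n IH] x; rewrite -[x](subrK (z * divz m x)) (dualD phi) (dualD psi) eK !psaddE;
  by rewrite !order_dual_zelt ?IH.
Qed.

(** The quotient of [phi] by t. *)
Definition dual_shift (phi : dual Lambda) (phi0 : forall x, dfun phi x 0%N = 0) :
  dual Lambda.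
Proof.
refine (@mkdual (fun x n => dfun phi x n.+1) _ _ _) => [x y|a x n|x n].
- by apply: funext => n; rewrite dualD.
- exact: order_dualZ.
- by rewrite order_dual_zelt; case: n.
Defined.

Lemma dual_mod_zelt (phi : dual Lambda) x y :
  pi x = pi y -> dfun phi x 0%N = dfun phi y 0%N.
Proof.
move=> /bpiP[w e]; rewrite -[x](subrK y) e dualD.
by rewrite psaddE order_dual_zelt add0r.
Qed.

Definition dual_red (phi : dual Lambda) : dual A.
Proof.
refine (@Dual _ _ A (fun u : brauer k m => dfun phi (repr u) 0%N) _ _) => [u v|a u].
  by rewrite -psaddE -dualD; apply: dual_mod_zelt; rewrite bpiD !bpiK.
by rewrite -order_dualZ; apply: dual_mod_zelt; rewrite bpiZ !bpiK.
Defined.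

Lemma dual_redE (phi : dual Lambda) x : dfun (dual_red phi) (pi x) = dfun phi x 0%N.
Proof. exact/dual_mod_zelt/bpiK. Qed.

Lemma divz_iterD n x y :
  iter n (divz m) (x + y) = iter n (divz m) x + iter n (divz m) y.
Proof. by elim: n => //= n ->; rewrite divzD. Qed.

Lemma divz_iterZ n (a : k) x :
  iter n (divz m) (cscal a * x) = cscal a * iter n (divz m) x.
Proof. by elim: n => //= n ->; rewrite divzZ. Qed.

(** The iterates of [divz] play the role of digits of a z-adic expansion. Compatibility with [z]
    holds since [divz] is a left inverse of multiplication by [z] and [psi] vanishes on multiples of
    [z]. *)
Definition dual_lift (psi : dual A) : dual Lambda.
Proof.
refine (@mkdual (fun x n => dfun psi (pi (iter n (divz m) x))) _ _ _) => [x y|a x n|x n].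
- by apply: funext => n; rewrite divz_iterD bpiD dualD.
- by rewrite divz_iterZ bpiZ (dualZ psi).
- case: n => [|n]; last by rewrite iterSr divzK.
  rewrite (_ : pi _ = pi 0); last by apply/bpiP; exists x; rewrite subr0.
  by apply: (addrI (dfun psi (pi 0))); rewrite -dualD -bpiD !addr0.
Defined.

(** Injectivity: if the reductions of [phi (a -)] and [phi (b -)] agree, then [phi ((a - b) -)] is t
    times some [phi (w -)], so [a - b = z * w]. Surjectivity: lift the functional to Lambda and
    represent it there. *)
Lemma red_ract_bij (phi : dual_bimod Lambda) : bijective (ract phi) ->
  bijective (ract (dual_red phi : dual_bimod A)).
Proof.
move=> [g phiK Kphi]; apply: inj_surj_bij => [u v|psi].
  rewrite -[u]bpiK -[v]bpiK; move: (repr u) (repr v) => a b e.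
  have ab0 x : dfun phi ((a - b) * x) 0%N = 0.
    have abx : dfun (dual_red phi) (pi (a * x)) = dfun (dual_red phi) (pi (b * x)).
      by rewrite !bpiM; exact: (congr1 (fun f : dual A => dfun f (pi x)) e).
    rewrite !dual_redE in abx.
    have := dualD phi ((a - b) * x) (b * x); rewrite -mulrDl subrK.
    move/(congr1 (fun f => f 0%N)); rewrite psaddE abx.
    by rewrite -[LHS]add0r => /addIr.
  pose phi1 := dual_shift (phi := ract phi (a - b)) ab0.
  apply/bpiP; exists (g phi1); rewrite -[LHS]phiK -[RHS]phiK; congr g.
  apply: dual_eq => x; apply: funext => n /=; rewrite -mulrA order_dual_zelt.
  case: n => [|n]; first exact: ab0.
  by rewrite -[RHS]/(dfun (ract phi (g phi1)) x n) Kphi.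
exists (pi (g (dual_lift psi))); apply: dual_eq => u.
rewrite -[u]bpiK; move: (repr u) => x.
rewrite -[LHS]/(dfun (dual_red phi) (pi (g (dual_lift psi)) * pi x)) -bpiM dual_redE.
by rewrite -[LHS]/(dfun (ract phi (g (dual_lift psi))) x 0%N) Kphi.
Qed.

End ScalarExtension.

(** A bimodule isomorphism is determined by the image [phi] of 1, and compatibility with both
    actions amounts to the trace identity for [phi]. *)
Lemma symmetric_traceP (K : comPzRingType) (S : pzRingType) (al : algebra K S) :
  symmetric_alg al <-> exists phi : dual_bimod al,
    bijective (ract phi) /\ forall x y, dfun phi (x * y) = dfun phi (y * x).
Proof.
split=> [[f [fb _ fl fr]]|[phi [phib phiC]]].
  have fE a : f a = ract (f 1) a by rewrite -fr /= mul1r.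
  exists (f 1); split; first exact: eq_bij fb _ fE.
  move=> x y; have : lact y (f 1) = ract (f 1) y by rewrite -fE -fl /= mulr1.
  by move/(congr1 (fun h : dual al => dfun h x)).
exists (ract phi); split=> // [x y|a x|x a]; first exact: ractDr.
  by apply: dual_eq => y /=; rewrite -mulrA phiC mulrA.
exact: ractM.
Qed.

Lemma symmetric_order_brauer (k : fieldType) (Q : gentle_quiver) (m : multiplicity Q) :
  symmetric_alg (order_algebra k m) -> symmetric_alg (brauer_algebra k m).
Proof.
move=> /symmetric_traceP[phi [phib phiC]]; apply/symmetric_traceP.
exists (dual_red phi); split; first exact: red_ract_bij.
by move=> u v; rewrite -[u]bpiK -[v]bpiK -!bpiM !dual_redE phiC.
Qed.

(** * The Frobenius form *)

Section FrobeniusForm.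
Variables (k : fieldType) (Q : gentle_quiver) (m : multiplicity Q).
Variable eps : arrow Q -> k.
Hypotheses (eps2 : forall b, eps b * eps b = 1)
  (eps_sum : forall i : vertex Q, \sum_(b : arrow Q | src b == i) eps b = 0).
Local Notation L := (completion k Q).
Local Notation Lambda := (order_algebra k m).
Local Notation s := (sigma Q).
Local Notation Z := (zlen m).
Local Notation z := (zelt k m).
Implicit Types (b c : arrow Q) (x y : L) (j l n : nat).

Definition frob : dual Lambda.
Proof.
refine (@mkdual _ _ _ (fun x n => \sum_b eps b * x (pth b (Z b * n.+1))) _ _ _)
    => [x y|a x n|x n].
- apply: funext => n; rewrite psaddE -big_split /=; apply: eq_bigr => b _.
  by rewrite caddE mulrDr.
- by rewrite mulr_sumr; apply: eq_bigr => b _; rewrite cscalM mulrCA.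
- under eq_bigr => b _ do rewrite zelt_mul mulnS leq_addr addKn.
  case: n => [|n] //.
  under eq_bigr => b _ do rewrite muln0 -(pth0 (src_arrow_at (src b))).
  (* In degree 0 each arrow contributes the coefficient of the trivial path at its source, and the
     signs at a vertex cancel. *)
  rewrite (partition_big (@src Q) predT) //= big1 // => i _.
  transitivity ((\sum_(b : arrow Q | src b == i) eps b) * x (pth (arrow_at i) 0)).
    by rewrite mulr_suml; apply: eq_bigr => b /eqP ->.
  by rewrite eps_sum mul0r.
Defined.

Lemma frob_mpath x b j n : (0 < j <= Z b * n.+1)%N ->
  dfun frob (x * mpath k b j) n = eps b * x (pth (iter j s b) (Z b * n.+1 - j)).
Proof.
move=> /andP[j0 jn]; rewrite /= (bigD1 b) //= mul_mpath // eqxx jn /=.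
rewrite big1 ?addr0 // => c cb.
by rewrite mul_mpath // (negPf cb) mulr0.
Qed.

Lemma frob_ract_inj : injective (ract (frob : dual_bimod Lambda)).
Proof.
move=> x y exy; apply: pth_ext => c l; pose b := iter l s c.
have Zb : Z b = Z c by rewrite /b zlen_iter.
(* The power [l.+1] makes the cycle longer than [l]; [mpath b j] followed by [pth c l] is that power
   of the cycle at [b], so the form isolates the coefficient at [pth c l]. *)
have lZ : (l < Z c * l.+1)%N by rewrite leq_pmull ?zlen_gt0.
pose j := (Z c * l.+1 - l)%N.
have jn : (0 < j <= Z b * l.+1)%N by rewrite Zb subn_gt0 lZ leq_subr.
have : dfun frob (x * mpath k b j) l = dfun frob (y * mpath k b j) l :=
  congr1 (fun f : dual Lambda => dfun f (mpath k b j) l) exy.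
rewrite !frob_mpath //.
rewrite Zb subKn ?(ltnW lZ) // /b -iterD subnK ?(ltnW lZ) // iter_zlen.
by move/(congr1 (fun u => eps (iter l s c) * u)); rewrite !mulrA eps2 !mul1r.
Qed.

Lemma sum_two_src b c (V : nmodType) (F : arrow Q -> V) : b != c -> src b = src c ->
  \sum_(d : arrow Q | src d == src c) F d = F b + F c.
Proof.
move=> bc ebc; have /eqP/cards2P[u [v [uv e]]] := two_out (gentleP Q) (src c).
have sE d : (src d == src c) = (d \in [set u; v]) by rewrite -e inE.
have : b \in [set u; v] by rewrite -sE ebc.
have : c \in [set u; v] by rewrite -sE.
rewrite (eq_bigl _ _ sE) big_setU1 ?in_set1 //= big_set1 !inE.
case/orP=> /eqP ec /orP[] /eqP eb; rewrite ec eb ?eqxx // in bc *.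
by rewrite addrC.
Qed.

(* The inverse of a |-> frob (a -): on pth c l, it reads off the value of phi
   on the path that precedes pth c l in a power of c_c^m. *)
Definition frob_coord (phi : dual Lambda) : L := fun p =>
  let c := if (val p).2 is c :: _ then c else arrow_at (val p).1 in
  let b := iter (plen p) s c in
  eps b * dfun phi (mpath k b (Z c - plen p %% Z c)) (plen p %/ Z c)%N.

(** The case at stake is [l = 0], where [c] may differ from [arrow_at]. Exchanging the two arrows
    flips [eps], and also the value of [phi], as [phi] of z e_i has no constant term. *)
Lemma frob_coord_pth phi c l : frob_coord phi (pth c l) = let b := iter l s c in
  eps b * dfun phi (mpath k b (Z c - l %% Z c)) (l %/ Z c)%N.
Proof.
rewrite /frob_coord plen_pth; case: l => // /=.
rewrite !mod0n !div0n !subn0; set b := arrow_at _.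
have bc : src b = src c := src_arrow_at _.
have [->//|nbc] := eqVneq b c.
have eb : eps b = - eps c.
  by apply/eqP; rewrite -addr_eq0 -(sum_two_src _ nbc bc) eps_sum.
have pb : dfun phi (mpath k b (Z b)) 0%N = - dfun phi (mpath k c (Z c)) 0%N.
  apply/eqP; rewrite -addr_eq0 -psaddE -dualD.
  by rewrite -(sum_two_src (fun d => mpath k d (Z d)) nbc bc) -zelt_vertex order_dual_zelt.
by rewrite eb pb mulrNN.
Qed.

Lemma frob_coordK phi : ract (frob : dual_bimod Lambda) (frob_coord phi) = phi.
Proof.
apply: (@order_dual_ext _ _ m) => b l lZ; apply: funext => j.
rewrite -[LHS]/(dfun frob (frob_coord phi * mpath k b l) j).
case: l lZ => [_|l lZ].
  (* Multiplying by [z] raises the degree by one and replaces the trivial path by the two cycles at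
     its vertex, where the coordinates are known. *)
  transitivity (dfun phi (z * mpath k b 0) j.+1); last by rewrite order_dual_zelt.
  rewrite zelt_vertex (big_morph (fun u => dfun phi u j.+1)
    (id1 := 0) (op1 := +%R)); last 2 first.
  - by move=> u v; rewrite dualD.
  - by apply: (addrI (dfun phi 0 j.+1)); rewrite -psaddE -dualD !addr0.
  rewrite /= [RHS]big_mkcond; apply: eq_bigr => c _; rewrite mul_mpath0.
  case: eqP => _; last by rewrite mulr0.
  rewrite frob_coord_pth iter_zlen mulrA eps2 mul1r modnMr subn0.
  by rewrite mulKn ?zlen_gt0.
have lj : (0 < l.+1 <= Z b * j.+1)%N by rewrite (leq_trans lZ) // leq_pmulr.
rewrite frob_mpath // frob_coord_pth zlen_iter -iterD subnK //.
rewrite iter_zlen mulrA eps2 mul1r.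
(* Euclidean division by [Z b]: quotient [j], remainder [Z b - l.+1], so [frob_coord] evaluates
   [phi] on a path of length [l.+1] in degree [j]. *)
have e : (Z b * j.+1 - l.+1 = j * Z b + (Z b - l.+1))%N.
  by rewrite mulnS mulnC addnC addnBA.
have lt : (Z b - l.+1 < Z b)%N by rewrite ltn_subrL zlen_gt0.
rewrite e modnMDl modn_small // subKn // divnMDl ?zlen_gt0 //.
by rewrite divn_small // addn0.
Qed.

Lemma frob_bij : bijective (ract (frob : dual_bimod Lambda)).
Proof.
apply: inj_surj_bij; first exact: frob_ract_inj.
by move=> phi; exists (frob_coord phi); apply: frob_coordK.
Qed.

Lemma frob_trace : (forall b, eps (s b) = eps b) ->
  forall x y, dfun frob (x * y) = dfun frob (y * x).
Proof.
move=> eps_s x y; have eps_iter l b : eps (iter l s b) = eps b.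
  by elim: l => //= l <-.
pose fr : dual_bimod Lambda := frob.
suff e : lact y fr = ract fr y by exact: (congr1 (fun f : dual Lambda => dfun f x) e).
apply: (@order_dual_ext _ _ m) => b l lZ; apply: funext => n.
rewrite -[LHS]/(dfun frob (mpath k b l * y) n) -[RHS]/(dfun frob (y * mpath k b l) n).
case: l lZ => [_|l lZ].
  apply: eq_bigr => c _; congr (_ * _).
  by rewrite mul_mpath0 mpath_mul subn0 iter_zlen pth_eq.
have ln : (0 < l.+1 <= Z b * n.+1)%N by rewrite (leq_trans lZ) // leq_pmulr.
have [_ ln'] := andP ln.
(* Only the power of a cycle starting at [iter l.+1 s b] ends with the given path; it is a rotation
   of the one at [b], with the same sign. *)
rewrite frob_mpath // [LHS](bigD1 (iter l.+1 s b)) // zlen_iter eps_iter.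
rewrite mpath_mul ln' -iterD subnK // iter_zlen eqxx /= big1 ?addr0 // => c cb.
rewrite mpath_mul; case: ifP => [|_]; last by rewrite mulr0.
case/andP=> lc; rewrite pth_eq eqxx => /eqP eb; case/eqP: cb.
by rewrite -eb -iterS -iterD subnKC // iter_zlen.
Qed.

End FrobeniusForm.

(** * Signs and bipartiteness *)

Section Bipartite.
Variables (k : fieldType) (Q : gentle_quiver) (m : multiplicity Q).
Local Notation s := (sigma Q).
Local Notation Z := (zlen m).
Local Notation z := (zelt k m).
Local Notation A := (brauer_algebra k m).
Implicit Types (b c : arrow Q).

Lemma frobenius_sign : exists eps : arrow Q -> k,
  (forall b, eps b * eps b = 1) /\
  forall i : vertex Q, \sum_(b : arrow Q | src b == i) eps b = 0.
Proof.
pose eps b : k := if b == arrow_at (src b) then 1 else -1.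
exists eps; split=> [b|i]; first by rewrite /eps; case: ifP; rewrite ?mulrNN mulr1.
have /eqP/cards2P[c [d [cd e]]] := two_out (gentleP Q) i.
have ci : src c = i by apply/eqP; have := set21 c d; rewrite -e inE.
have di : src d = i by apply/eqP; have := set22 c d; rewrite -e inE.
have : arrow_at i \in [set c; d] by rewrite -e inE src_arrow_at.
rewrite -{2}di (sum_two_src _ cd) ?ci // /eps ci di !inE.
case/orP=> /eqP ->; rewrite !eqxx.
  by rewrite eq_sym (negPf cd) subrr.
by rewrite (negPf cd) addNr.
Qed.

Lemma orb_sigma b : orb (s b) = orb b.
Proof.
by apply: val_inj; apply/eqP; rewrite eq_porbit_mem -[s]expg1 mem_porbit.
Qed.

Lemma orb_invariant (T : Type) (f : arrow Q -> T) :
  (forall b, f (s b) = f b) -> forall b c, orb b = orb c -> f b = f c.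
Proof.
move=> fs b c /(congr1 val)/= e; have : b \in porbit s c by rewrite -e porbit_id.
move=> /porbitP[n ->]; elim: n => [|n IH]; first by rewrite expg0 perm1.
by rewrite expgSr permM fs.
Qed.

Lemma bipartite_symmetric :
  bipartite (quiver_graph Q) \/ (2 \in [pchar k])%N ->
  symmetric_alg (order_algebra k m).
Proof.
have tr eps (eps2 : forall b, eps b * eps b = 1 :> k)
    (eps_sum : forall i : vertex Q, \sum_(b : arrow Q | src b == i) eps b = 0) :
    (forall b, eps (s b) = eps b) -> symmetric_alg (order_algebra k m).
  move=> eps_s; apply/symmetric_traceP; exists (frob m eps_sum).
  by split; [apply: frob_bij|apply: frob_trace].
case=> [[col colP]|k2].
  apply: (tr (fun b => (-1) ^+ (col (orb b) : bool))) => [b|i|b]; last by rewrite orb_sigma.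
    by rewrite -expr2 sqrr_sign.
  have /eqP/cards2P[c [d [cd e]]] := two_out (gentleP Q) i.
  have ci : src c = i by apply/eqP; have := set21 c d; rewrite -e inE.
  have di : src d = i by apply/eqP; have := set22 c d; rewrite -e inE.
  rewrite -di (sum_two_src _ cd) ?ci //.
  have : col (orb c) != col (orb d).
    apply: (colP i); apply/existsP; exists c; apply/existsP; exists d.
    by rewrite cd ci di !eqxx.
  by case: (col _); case: (col _) => //= _; rewrite expr0 expr1 ?subrr ?addNr.
apply: (tr (fun _ => 1)) => [_|i|//]; first exact: mulr1.
rewrite sumr_const -[RHS](pcharf0 k2) -(two_out (gentleP Q) i); congr (_ *+ _).
by apply: eq_card => b; rewrite inE.
Qed.

Lemma symmetric_bipartite : symmetric_alg A ->
  bipartite (quiver_graph Q) \/ (2 \in [pchar k])%N.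
Proof.
move=> /symmetric_traceP[phi [phib phiC]].
have [k2|nk2] := boolP (2 \in [pchar k])%N; [by right|left].
pose f x := dfun phi (bpi m x).
have fD x y : f (x + y) = f x + f y by rewrite /f bpiD dualD.
have fZ a x : f (cscal a * x) = a * f x by rewrite /f bpiZ (dualZ phi).
have fC x y : f (x * y) = f (y * x) by rewrite /f !bpiM phiC.
have f0 : f 0 = 0 by apply: (addrI (f 0)); rewrite -fD !addr0.
have fz x : f (z * x) = 0.
  by rewrite -f0 /f; congr (dfun phi _); apply/bpiP; exists x; rewrite subr0.
pose g b := f (mpath k b (Z b)).
(* The cycles at [b] and [s b] are the two products of [b] with one common path, so the trace
   identity equates their values. *)
have gs b : g (s b) = g b.
  rewrite /g; have Zs : Z (s b) = Z b := zlen_iter m b 1.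
  have ZS : Z b = (Z b).-1.+1 by rewrite prednK ?zlen_gt0.
  have e1 : mpath k (s b) (Z b).-1 * mpath k b 1 = mpath k b (Z b).
    by have := mpathM k b 1 (Z b).-1; rewrite add1n -ZS.
  have e2 : mpath k b 1 * mpath k (s b) (Z b).-1 = mpath k (s b) (Z b).
    have := mpathM k (s b) (Z b).-1 1; rewrite addn1 -ZS => <-.
    by rewrite -iterSr -ZS iter_zlen1.
  by rewrite Zs -e2 -e1 fC.
have gN b c : b != c -> src b = src c -> g b = - g c.
  move=> bc ebc; apply/eqP; rewrite -addr_eq0.
  rewrite -fD -(sum_two_src (fun d => mpath k d (Z d)) bc ebc) -zelt_vertex.
  by rewrite fz.
(* If [g b = 0], the form vanishes on the right ideal of c_b^m, so nondegeneracy puts c_b^m into z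
   Lambda; comparing coefficients at c_b^m and c_c^m excludes this. *)
have g0 b c : b != c -> src b = src c -> g b != 0.
  move=> bc ebc; apply: contraNneq bc => gb0.
  have : f \o *%R (mpath k b (Z b)) =1 fun _ => 0.
    move=> x /=; rewrite -[x](subrK (z * divz m x)) mulrDr fD.
    rewrite [X in _ + f X]mulrA -zelt_central -mulrA fz addr0.
    apply: (span_mod_zelt (K := fun x => f (mpath k b (Z b) * x) = 0)).
    - by rewrite mulr0.
    - by move=> u v u0 v0; rewrite mulrDr fD u0 v0 addr0.
    - move=> a u u0; rewrite mulrA (_ : mpath k b (Z b) * cscal a = cscal a * mpath k b (Z b)).
        by rewrite -mulrA fZ u0 mulr0.
      by apply: funext => p; rewrite cMscal cscalM.
    (* The product of c_b^m with a path is c_b^m itself, zero, or, for a longer composable path, a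
       multiple of [z]. *)
    move=> d l _; have [->|l0] := posnP l.
      have [e|e] := eqVneq (src b) (src d).
        by rewrite -[mpath k d 0](_ : mpath k b 0 = _) ?(mpathM k b 0) //; rewrite /mpath e.
      rewrite (_ : _ * _ = 0) //; apply: pth_ext => a j; rewrite mul_mpath0.
      case: eqP => // ad; rewrite mpathE pth_eq.
      case: (Z b) (zlen_gt0 m b) => // n _.
      by case: (eqVneq a b) => [ab|]; rewrite ?andbF //; case/eqP: e; rewrite -ab.
    have [e|e] := eqVneq b (iter l s d).
      rewrite e mpathM zlen_iter.
      by rewrite -zelt_mpath // fz.
    rewrite (_ : _ * _ = 0) //; apply: pth_ext => a j; rewrite mul_mpath //.
    case: ifP => // _; rewrite mpathE pth_eq.
    case: (Z b) (zlen_gt0 m b) => // n _.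
    by rewrite (eq_sym _ b) (negPf e) andbF.
  move=> fb0; have /(bij_inj phib) : ract phi (bpi m (mpath k b (Z b))) = ract phi 0.
    apply: dual_eq => u; rewrite -[u]bpiK /= -bpiM mul0r.
    rewrite -[LHS]/(f (_ * _)) [LHS]fb0.
    by apply/esym; apply: (addrI (dfun phi 0)); rewrite -dualD !addr0.
  move=> e; have /bpiP[w ew] : bpi m (mpath k b (Z b)) = bpi m 0 by rewrite e bpi0.
  rewrite subr0 in ew.
  have : mpath k b (Z b) (pth b (Z b)) = mpath k b (Z b) (pth c (Z c)).
    by rewrite ew !zelt_mul !leqnn !subnn (pth0 ebc).
  rewrite !mpathE eqxx pth_eq; case: (Z b) (zlen_gt0 m b) => // n _.
  by case: (eqVneq c b) => // _; rewrite andbF => /eqP; rewrite oner_eq0.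
(* [g] descends to nodes of the graph; at [orb b] the default 0 is never taken. *)
pose gv (v : sorbit Q) := if [pick b | orb b == v] is Some b then g b else 0.
have gvE b : gv (orb b) = g b.
  rewrite /gv; case: pickP => [c /eqP e|/(_ b)]; last by rewrite eqxx.
  exact: orb_invariant gs _ _ e.
(* A choice depending only on the unordered pair of [u] and [- u]. *)
pose rep (u : k) := choose (pred2 u (- u)) u.
have repN u : rep (- u) = rep u.
  have e : pred2 (- u) (- - u) =1 pred2 u (- u) by move=> w /=; rewrite opprK orbC.
  by rewrite /rep (eq_choose e); apply: choose_id; rewrite /= eqxx ?orbT.
have repP u : (rep u == u) || (rep u == - u).
  by apply: (chooseP (P := pred2 u (- u))); rewrite /= eqxx.
exists (fun v => gv v == rep (gv v)) => i u v /existsP[b /existsP[c]].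
case/and3P=> [bc /eqP bi /andP[/eqP ci /andP[/eqP -> /eqP ->]]].
have ebc : src b = src c by rewrite bi ci.
have gb0 := g0 _ _ bc ebc; rewrite !gvE (gN _ _ bc ebc) repN.
rewrite (gN _ _ bc ebc) oppr_eq0 in gb0.
have gcN : - g c != g c.
  by rewrite eq_sym -addr_eq0 -mulr2n -mulr_natl mulf_neq0.
by case/orP: (repP (g c)) => /eqP ->; rewrite ?eqxx ?[g c == - _]eq_sym (negPf gcN).
Qed.

End Bipartite.

(* MathComp world.  Lambda := completion k Q is the k[[t]]-order with t |-> z,
   and A := brauer k m = Lambda / z Lambda. *)
Theorem theoremC (k : fieldType) (Q : gentle_quiver) (m : multiplicity Q) :
  let Lambda := order_algebra k m in
  let A := brauer_algebra k m in
  [/\ symmetric_alg Lambda <-> nakayama_iso_id Lambda,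
      nakayama_iso_id Lambda <-> serre_order_iso_shift Lambda,
      symmetric_alg A <-> nakayama_iso_id A
    & nakayama_iso_id A <-> serre_alg_iso_id A] /\
  [/\ symmetric_alg Lambda <-> symmetric_alg A
    & symmetric_alg A <->
        bipartite (quiver_graph Q) \/ (2 \in [pchar k])%N].
Proof.
move=> Lambda A.
have [eps [eps2 eps_sum]] := frobenius_sign k Q.
have frobL := frob_bij m eps2 eps_sum; have frobA := red_ract_bij frobL.
have [symL symA] := (@symmetric_nakayama _ _ Lambda, @symmetric_nakayama _ _ A).
have [serreL serreA] := (serre_order_symmetric frobL, serre_order_symmetric frobA).
have [nakL nakA] := (@nakayama_serre_order _ _ Lambda, @nakayama_serre_order _ _ A).
have LA := @symmetric_order_brauer k Q m.
have [bL Ab] := (@bipartite_symmetric k Q m, @symmetric_bipartite k Q m).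
by split; split; split=> //; auto.
Qed.
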